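(* Let $\theta>1$ and $\nu>-1$. For all integers $k,m\ge 0$, $$\frac{2\theta^{-\nu/2}}{\pi(\theta-1)}\int_{\mathbb{C}}L^{\nu}_k(z)\overline{L^{\nu}_m(z)}\exp\left(\frac{2\operatorname{Re} z}{\theta-1}\right)|z|^{\nu}K_{\nu}\left(\frac{2\sqrt{\theta}\,|z|}{\theta-1}\right)d\sigma(z)=\delta_{k,m}\frac{\Gamma(k+\nu+1)\,\theta^k}{k!}.$$
   Context: $L^{\nu}_k$ is the $k$-th (generalized) Laguerre polynomial in the standard normalization, $L^\nu_k(x)=\frac{x^{-\nu}e^{x}}{k!}\frac{d^k}{dx^k}\left(e^{-x}x^{k+\nu}\right)$, so that $\int_0^\infty L^\nu_k(x)L^\nu_m(x)x^\nu e^{-x}dx=\delta_{k,m}\Gamma(k+\nu+1)/k!$. $K_\nu$ is the modified Bessel function of the second kind (Macdonald function). $d\sigma$ is Lebesgue area measure on $\mathbb{C}$ and $\delta_{k,m}$ is the Kronecker delta. *)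

(* Defs.v *)
From HB Require Import structures.
From mathcomp Require Import all_boot all_order all_algebra ring.
From mathcomp Require Import all_classical all_reals all_analysis.
From mathcomp Require Import complex.

Set Implicit Arguments.
Unset Strict Implicit.
Unset Printing Implicit Defensive.

Import Order.TTheory GRing.Theory Num.Theory.
Import numFieldNormedType.Exports.

Local Open Scope classical_set_scope.
Local Open Scope ring_scope.

Section defs.
Context {R : realType}.

Local Notation mu := (@lebesgue_measure R).
Local Notation area := (mu \x mu)%E.

(* Euler's integral, convergent exactly for 0 < s. *)
Definition Gamma (s : R) : R :=
  \int[mu]_(t in `]0, +oo[) (t `^ (s - 1) * expR (- t)).

Definition cosh (t : R) : R := (expR t + expR (- t)) / 2.

(* The Macdonald function for x > 0, by its classical integral
   K_nu(x) = \int_0^oo exp(-x cosh t) cosh(nu t) dt; the integral diverges for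
   x <= 0, where the value is a default that carries no meaning. *)
Definition besselK (nu x : R) : R :=
  \int[mu]_(t in `[0, +oo[) (expR (- (x * cosh t)) * cosh (nu * t)).

(* x^(-nu) e^x / k! (d/dx)^k (e^(-x) x^(k + nu)), meaningful for x > 0 *)
Definition rodrigues (nu : R) (k : nat) (x : R) : R :=
  x `^ (- nu) * expR x / k`!%:R *
  derive1n k (fun t => expR (- t) * t `^ (k%:R + nu)) x.

(* Taken as a polynomial so that it can be evaluated at complex points;
   laguerreE and laguerre_unique show that the Rodrigues formula on the
   positive half-line does determine exactly one polynomial. *)
Definition laguerre (nu : R) (k : nat) : {poly R} :=
  xget 0 [set p : {poly R} | forall x, 0 < x -> p.[x] = rodrigues nu k x].

Definition laguerreC (nu : R) (k : nat) (z : R[i]) : R[i] :=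
  (map_poly (real_complex R) (laguerre nu k)).[z].

(* R[i] carries no measure in the library: integrals over C with respect to
   area are integrals over R * R through the identification (x, y) = x + iy. *)
Definition Cintegrable (f : R[i] -> R[i]) : Prop :=
  area.-integrable setT (fun p => (complex.Re (f (p.1 +i* p.2)%C))%:E) /\
  area.-integrable setT (fun p => (complex.Im (f (p.1 +i* p.2)%C))%:E).

Definition Cintegral (f : R[i] -> R[i]) : R[i] :=
  ((\int[area]_p complex.Re (f (p.1 +i* p.2)%C)) +i*
   (\int[area]_p complex.Im (f (p.1 +i* p.2)%C)))%C.

Fixpoint rodrigues_poly (a : R) (j : nat) : {poly R} :=
  if j is i.+1 then
    (a - i%:R)%:P * rodrigues_poly a i - 'X * rodrigues_poly a i
      + 'X * (rodrigues_poly a i)^`()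
  else 1.

Lemma derive1n_rodrigues (a : R) (j : nat) (x : R) : 0 < x ->
  derive1n j (fun t => expR (- t) * t `^ a) x
  = expR (- x) * x `^ (a - j%:R) * (rodrigues_poly a j).[x].
Proof.
elim: j x => [|j IHj] x x0; first by rewrite subr0 hornerE mulr1.
rewrite derive1nS derive1E.
rewrite (near_eq_derive (g := fun t =>
  expR (- t) * t `^ (a - j%:R) * (rodrigues_poly a j).[t])) ?oner_neq0//; last first.
  by near=> t; apply: IHj; near: t; exact: lt_nbhsr.
have dpow := is_derive1_powR (a - j%:R) x0.
have -> : x `^ (a - j.+1%:R) = x `^ (a - j%:R - 1).
  by congr (_ `^ _); rewrite -natr1; ring.
have xP : x `^ (a - j%:R) = x `^ (a - j%:R - 1) * x.
  rewrite -[X in _ * X](powRr1 (ltW x0)) -powRD ?subrK//.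
  by rewrite (gt_eqF x0) implybT.
rewrite derive_val /= !hornerE /GRing.scale/= xP.
ring.
Unshelve. all: by end_near. Qed.

Lemma laguerreE (nu : R) (k : nat) (x : R) : 0 < x ->
  (laguerre nu k).[x] = rodrigues nu k x.
Proof.
move: x; rewrite /laguerre; case: xgetP => [p _ //|/= noL].
exfalso; apply: (noL (k`!%:R^-1 *: rodrigues_poly (k%:R + nu) k)) => x x0.
rewrite /rodrigues derive1n_rodrigues// hornerZ addrAC subrr add0r.
rewrite powRN expRN; set P := _.[x].
have E0 : expR x != 0 by rewrite gt_eqF// expR_gt0.
have X0 : x `^ nu != 0 by rewrite gt_eqF// powR_gt0.
have K0 : k`!%:R != 0 :> R by rewrite pnatr_eq0 -lt0n fact_gt0.
by field; rewrite K0 E0 X0.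
Qed.

Lemma laguerre_unique (nu : R) (k : nat) (p : {poly R}) :
  (forall x, 0 < x -> p.[x] = rodrigues nu k x) -> p = laguerre nu k.
Proof.
move=> pE; apply/eqP; rewrite -subr_eq0; apply/negP => /negP q0.
have := max_poly_roots (rs := [seq i.+1%:R | i <- iota 0 (size (p - laguerre nu k))]) q0.
rewrite size_map size_iota ltnn => H; apply: notF; apply: H.
  apply/allP => _ /mapP[i _ ->].
  by rewrite rootE hornerD hornerN pE ?laguerreE ?subrr// ltr0n.
by rewrite map_inj_uniq ?iota_uniq// => i j /eqP; rewrite eqr_nat eqSS => /eqP.
Qed.

End defs.

(* Main.v *)
Require Import Defs.
From HB Require Import structures.
From mathcomp Require Import all_boot all_order all_algebra.
From mathcomp Require Import ring lra.
From mathcomp Require Import all_classical all_reals all_analysis.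
From mathcomp Require Import measurable_realfun.
From mathcomp Require Import complex.

Set Implicit Arguments.
Unset Strict Implicit.
Unset Printing Implicit Defensive.

Import Order.TTheory GRing.Theory Num.Theory.
Import numFieldNormedType.Exports.

Local Open Scope classical_set_scope.
Local Open Scope ring_scope.

(* Put c = 1 / (theta - 1).  Schlafli's integral writes the weight
   exp(2c Re z) |z|^nu K_nu(2c sqrt(theta) |z|) as a superposition over t > 0
   of t^(nu - 1) e^(-t) exp(-(c / t) |z - t|^2), that is, of planar Gaussians
   centred at the real point t with variance t / (2c) in each coordinate.
   Gaussian integration by parts gives, against the normalised Gaussian,
     E[p(z) conj(q(z))] = \sum_r (theta - 1)^r t^r / r! p^(r)(t) q^(r)(t)
   for real polynomials p and q, and the total mass pi t / c turns the
   remaining weight into t^nu e^(-t).  The Laguerre differential equation, used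
   for L_k' , L_k'', and so on, gives
     \int t^(nu + r) e^(-t) L_k^(r) L_m^(r) dt
       = k (k - 1) ... (k - r + 1) \int t^nu e^(-t) L_k L_m dt,
   so the sum over r collapses to (1 + (theta - 1))^k = theta^k times the
   classical inner product, whose norm is read off from the case r = k.
   On the analytic side t = e^u throughout, so all integrals run over R. *)

(** * Moments of planar Gaussians *)

Section gaussian_moments.
Context {K : comNzRingType} (kappa : K).

(* [gmom s n] is E[x^n] for a real Gaussian x of mean s(t) and variance
   [kappa * t], as a polynomial in t = 'X. *)
Fixpoint gmom (s : {poly K}) (n : nat) : {poly K} :=
  match n with
  | 0 => 1
  | n1.+1 => s * gmom s n1 +
      match n1 with
      | 0 => 0
      | n2.+1 => n1%:R * (kappa%:P * 'X) * gmom s n2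
      end
  end.

Lemma gmomS s n :
  gmom s n.+1 = s * gmom s n + n%:R * (kappa%:P * 'X) * gmom s n.-1.
Proof. by case: n => //=; rewrite !mul0r. Qed.

Variable iota : K.

(* [cmom i j n l] is E[z^i conj(z)^j x^n y^l] for z = x + iota y with x of mean
   t, y of mean 0, both of variance [kappa * t] and independent; the exponents
   n and l only serve the recursion and the integrations by parts. *)

Fixpoint cmom0 (j n l : nat) : {poly K} :=
  if j is j'.+1 then cmom0 j' n.+1 l - iota%:P * cmom0 j' n l.+1
  else gmom 'X n * gmom 0 l.

Fixpoint cmom (i j n l : nat) : {poly K} :=
  if i is i'.+1 then cmom i' j n.+1 l + iota%:P * cmom i' j n l.+1
  else cmom0 j n l.

Lemma cmomSl i j n l :
  cmom i.+1 j n l = cmom i j n.+1 l + iota%:P * cmom i j n l.+1.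
Proof. by []. Qed.

Lemma cmomSr i j n l :
  cmom i j.+1 n l = cmom i j n.+1 l - iota%:P * cmom i j n l.+1.
Proof. by elim: i n l => [//|i IH] n l; rewrite !cmomSl !IH; ring. Qed.

Lemma cmom0Sj j n l :
  cmom0 j.+1 n l = cmom0 j n.+1 l - iota%:P * cmom0 j n l.+1.
Proof. by []. Qed.

Local Notation k := (kappa%:P * 'X).

(** Gaussian integration by parts in x: E[x f] = t E[f] + kappa t E[df/dx], where conj(z)^j has
    x-derivative j conj(z)^(j-1). A predecessor of 0 always carries the coefficient 0. *)
Lemma cmom0_Sx j n l : cmom0 j n.+1 l = 'X * cmom0 j n l +
  k * (n%:R * cmom0 j n.-1 l + j%:R * cmom0 j.-1 n l).
Proof.
elim: j n l => [|j IH] n l; first by rewrite /cmom0 gmomS; ring.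
rewrite !cmom0Sj (IH n.+1) (IH n l.+1).
case: n => [|n]; case: j IH => [|j] IH; rewrite ?succnK ?cmom0Sj; ring.
Qed.

(** The same in y, whose mean is 0; the y-derivative of conj(z)^j is -iota j conj(z)^(j-1). *)
Lemma cmom0_Sy j n l : cmom0 j n l.+1 =
  k * (l%:R * cmom0 j n l.-1 - iota%:P * j%:R * cmom0 j.-1 n l).
Proof.
elim: j n l => [|j IH] n l; first by rewrite /cmom0 gmomS; ring.
rewrite !cmom0Sj (IH n.+1) (IH n l.+1).
case: l => [|l]; case: j IH => [|j] IH; rewrite ?succnK ?cmom0Sj; ring.
Qed.

Lemma cmom_Sx i j n l : cmom i j n.+1 l = 'X * cmom i j n l +
  k * (n%:R * cmom i j n.-1 l + i%:R * cmom i.-1 j n l +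
       j%:R * cmom i j.-1 n l).
Proof.
elim: i n l => [|i IH] n l; first by rewrite /= cmom0_Sx; ring.
rewrite !cmomSl (IH n.+1) (IH n l.+1).
case: n => [|n]; case: i IH => [|i] IH; rewrite ?succnK ?cmomSl; ring.
Qed.

Hypothesis iota2 : iota * iota = -1.

Let iotaP2 : iota%:P * iota%:P = -1 :> {poly K}.
Proof. by rewrite -polyCM iota2 polyCN polyC1. Qed.

Lemma cmom_Sy i j n l : cmom i j n l.+1 =
  k * (l%:R * cmom i j n l.-1 + iota%:P * i%:R * cmom i.-1 j n l -
       iota%:P * j%:R * cmom i j.-1 n l).
Proof.
elim: i n l => [|i IH] n l; first by rewrite /= cmom0_Sy; ring.
rewrite !cmomSl (IH n.+1) (IH n l.+1).
case: l => [|l]; case: i IH => [|i] IH; rewrite ?succnK ?cmomSl; ring.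
Qed.

(** When the integrations by parts for x and iota y are added, the terms in z^(i-1) cancel because
    iota^2 = -1, and those in conj(z)^(j-1) double: the real derivatives combine into the Wirtinger
    derivative in conj(z). *)
Lemma cmom_rec i j : cmom i.+1 j 0 0 =
  'X * cmom i j 0 0 + (2 * kappa)%:P * 'X * (j%:R * cmom i j.-1 0 0).
Proof.
rewrite cmomSl cmom_Sx cmom_Sy polyCM polyCMn polyC1.
by have := iotaP2; set I := iota%:P => I2; ring: I2.
Qed.

(** Mean value property: conj(z)^j is harmonic, so its expectation is its value at the centre t. The
    derivative terms in x and y cancel. *)
Lemma cmom0_rec j : cmom 0 j 0 0 = 'X^j.
Proof.
elim: j => [|j IH]; first by rewrite /= expr0 mulr1.
rewrite cmomSr cmom_Sx cmom_Sy IH exprS.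
by have := iotaP2; set I := iota%:P => I2; ring: I2.
Qed.

End gaussian_moments.

(** * Gaussian expectations expanded in derivatives at the mean *)

Section reproducing.
Context {K : numFieldType} (tau : K).

Lemma derivnXM (p : {poly K}) r :
  ('X * p)^`(r) = 'X * p^`(r) + r%:R * p^`(r.-1).
Proof.
elim: r => [|r IH]; first by rewrite !derivn0; ring.
rewrite derivnS IH derivD !derivM derivX.
rewrite -[r%:R]polyC_natr derivC -derivnS succnK polyC_natr.
by case: r {IH} => [|r]; rewrite ?succnK -?derivnS; ring.
Qed.

Definition gdual_term r (p q : {poly K}) : {poly K} :=
  (tau ^+ r / r`!%:R)%:P * 'X^r * (p^`(r) * q^`(r)).

(** For tau = 2 kappa, q with real coefficients and [N] at least [size p], this is
    E[p(z) conj(q(z))] as a polynomial in the mean t = 'X. *)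
Definition gdual (N : nat) (p q : {poly K}) : {poly K} :=
  \sum_(r < N) gdual_term r p q.

Lemma gdualDl N p1 p2 q : gdual N (p1 + p2) q = gdual N p1 q + gdual N p2 q.
Proof.
rewrite -big_split; apply: eq_bigr => r _ /=.
by rewrite /gdual_term derivnD; ring.
Qed.

Lemma gdualDr N p q1 q2 : gdual N p (q1 + q2) = gdual N p q1 + gdual N p q2.
Proof.
rewrite -big_split; apply: eq_bigr => r _ /=.
by rewrite /gdual_term derivnD; ring.
Qed.

Lemma gdualZl N a p q : gdual N (a *: p) q = a *: gdual N p q.
Proof.
rewrite scaler_sumr; apply: eq_bigr => r _ /=.
by rewrite /gdual_term derivnZ -!mul_polyC; ring.
Qed.

Lemma gdualZr N a p q : gdual N p (a *: q) = a *: gdual N p q.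
Proof.
rewrite scaler_sumr; apply: eq_bigr => r _ /=.
by rewrite /gdual_term derivnZ -!mul_polyC; ring.
Qed.

Lemma gdual_widen N M (p q : {poly K}) : (size p <= N <= M)%N ->
  gdual M p q = gdual N p q.
Proof.
move=> /andP[pN NM]; rewrite /gdual (big_ord_widen M (fun r => gdual_term r p q) NM).
rewrite [LHS](bigID (fun r : 'I_M => (r < N)%N))/= [X in _ + X]big1 ?addr0//.
move=> r; rewrite -leqNgt => Nr.
by rewrite /gdual_term derivn_poly0 ?(leq_trans pN)//; ring.
Qed.

(** By the Leibniz rule, the r-th derivative of 'X p is 'X p^(r) + r p^(r-1); the second terms,
    reindexed by r - 1, form the pairing of p with q'. *)
Lemma gdualXM N (p q : {poly K}) : (size p < N)%N ->
  gdual N ('X * p) q = 'X * gdual N p q + tau%:P * 'X * gdual N p q^`().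
Proof.
move=> pN; case: N pN => // N pN.
(* Reindexing leaves only [N] terms for the pairing with q'; the term r = [N] vanishes because
   [size p] is at most [N]. *)
rewrite (@gdual_widen N N.+1 p q^`()) ?leqnSn ?andbT//.
rewrite /gdual [LHS]big_ord_recl [X in _ = 'X * X + _]big_ord_recl.
rewrite mulrDr -addrA; congr (_ + _).
  by rewrite /gdual_term !derivn0; ring.
rewrite !mulr_sumr -big_split; apply: eq_bigr => r _; cbv beta.
rewrite /gdual_term lift0 derivnXM succnK -derivSn.
have -> : tau ^+ r.+1 / r.+1`!%:R = (r.+1%:R)^-1 * tau * (tau ^+ r / r`!%:R).
  by rewrite factS natrM exprS invfM; ring.
have Sr : (r.+1%:R^-1)%:P * r.+1%:R = 1 :> {poly K}.
  by rewrite -polyC_natr -polyCM mulVf// pnatr_eq0.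
rewrite exprS !polyCM.
set a := (r.+1%:R^-1)%:P in Sr *.
set b := (tau ^+ r)%:P; set c := (r`!%:R^-1)%:P.
rewrite [RHS]/=.
by move: (r.+1%:R : {poly K}) Sr => n Sr; ring: Sr.
Qed.

(** The row i = 0 and the recurrence determine such an array, and by [gdualXM] the pairing of
    monomials obeys both. [F] will be the array of moments E[z^i conj(z)^j]. *)
Lemma gdualXn (F : nat -> nat -> {poly K}) :
  (forall j, F 0 j = 'X^j) ->
  (forall i j, F i.+1 j = 'X * F i j + tau%:P * 'X * (j%:R * F i j.-1)) ->
  forall N i j, (i < N)%N -> gdual N 'X^i 'X^j = F i j.
Proof.
move=> F0 FS N; elim=> [|i IH] j iN.
  rewrite F0 expr0; case: N iN => // N _; rewrite /gdual big_ord_recl big1.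
    by rewrite /gdual_term !derivn0 fact0 divr1 !expr0 polyC1; ring.
  move=> r _; rewrite /gdual_term derivn_poly0; first by rewrite mul0r mulr0.
  by rewrite size_poly1.
rewrite exprS gdualXM ?size_polyXn// IH ?(ltnW iN)// FS.
rewrite derivXn -scaler_nat gdualZr IH ?(ltnW iN)//.
by rewrite -mul_polyC polyC_natr.
Qed.

End reproducing.

(** * Laguerre equation and orthogonality *)

Section orthogonality.
Context {K : numFieldType} (a : K) (ell : {poly K} -> K).
Hypothesis ellD : {morph ell : p q / p + q}.
Hypothesis ellZ : forall c p, ell (c *: p) = c * ell p.

Lemma ell0 : ell 0 = 0.
Proof. by rewrite -(scale0r (0 : {poly K})) ellZ mul0r. Qed.

Lemma ell_sum (I : Type) (r : seq I) (P : pred I) (F : I -> {poly K}) :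
  ell (\sum_(i <- r | P i) F i) = \sum_(i <- r | P i) ell (F i).
Proof. by apply: (big_morph ell ellD ell0). Qed.

(** Integration by parts for the weight t^a e^(-t): the integrand is the derivative of t^(a+1)
    e^(-t) p(t). *)
Hypothesis ell_deriv : forall p, ell ('X * p^`() + (a + 1)%:P * p - 'X * p) = 0.

Lemma ell_derivn j p :
  ell ('X^j * ('X * p^`() + (a + j%:R + 1)%:P * p - 'X * p)) = 0.
Proof.
rewrite -[RHS](ell_deriv ('X^j * p)); congr ell.
rewrite derivM derivXn; case: j => [|j]; rewrite !polyCD ?polyC_natr ?expr0.
  by ring.
by rewrite succnK -mulr_natr exprS; ring.
Qed.

Definition laguerre_eigen (k : nat) (p : {poly K}) :=
  'X * p^`(2) + ((a + 1)%:P - 'X) * p^`() = - k%:R * p.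

(** Differentiating Laguerre's equation j times: p^(j) solves it with parameter a + j and eigenvalue
    k - j. *)
Lemma laguerre_eigen_derivn k p j : laguerre_eigen k p ->
  'X * p^`(j.+2) + ((a + j%:R + 1)%:P - 'X) * p^`(j.+1) =
  (j%:R - k%:R) * p^`(j).
Proof.
move=> pk; elim: j => [|j IH].
  by rewrite addr0 derivn1 derivn0 pk; ring.
move: IH; rewrite -!polyC_natr -polyCB => /(congr1 (@deriv K)).
rewrite derivD !derivM derivB derivX !derivC !mul0r -!derivnS.
rewrite polyCB !polyCD !polyC_natr => /eqP; rewrite -subr_eq0 => /eqP e.
by apply/eqP; rewrite -subr_eq0 -e; apply/eqP; ring.
Qed.

(** In self-adjoint form the equation for p^(j) reads (t^(a+j+1) e^(-t) p^(j+1))' = -(k - j) t^(a+j)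
    e^(-t) p^(j). It is paired with q^(j) and integrated by parts. *)
Lemma ell_eigenS k p q j : laguerre_eigen k p ->
  ell ('X^(j.+1) * (p^`(j.+1) * q^`(j.+1))) =
  (k%:R - j%:R) * ell ('X^j * (p^`(j) * q^`(j))).
Proof.
move=> /(laguerre_eigen_derivn j) pk.
apply/eqP; rewrite -subr_eq0 -mulNr -ellZ -ellD; apply/eqP.
rewrite -[RHS](ell_derivn j (p^`(j.+1) * q^`(j))); congr ell.
rewrite derivM -!derivnS -mul_polyC polyCN polyCB !polyC_natr opprB.
set u := p^`(j) in pk *; set v := q^`(j); set w := q^`(j.+1).
have -> : (j%:R - k%:R) * ('X^j * (u * v)) = 'X^j * v * ((j%:R - k%:R) * u).
  by ring.
by rewrite -pk exprS; ring.
Qed.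

Lemma ell_eigen k p q j : laguerre_eigen k p ->
  ell ('X^j * (p^`(j) * q^`(j))) = (k ^_ j)%:R * ell (p * q).
Proof.
move=> pk; elim: j => [|j IH].
  by rewrite expr0 mul1r ffactn0 mul1r !derivn0.
rewrite (ell_eigenS _ _ pk) IH ffactnSr natrM.
have [jk|kj] := leqP j k; first by rewrite natrB//; ring.
by rewrite ffact_small// !mul0r mulr0.
Qed.

(** For j = 1 the left side of [ell_eigen] is symmetric in p and q, so k ell(p q) = m ell(p q). *)
Lemma ell_eigen_orthogonal k m p q : laguerre_eigen k p ->
  laguerre_eigen m q -> k != m -> ell (p * q) = 0.
Proof.
move=> pk qm km.
have := ell_eigen q 1 pk; have := ell_eigen p 1 qm.
rewrite [q * p]mulrC [q^`(1) * _]mulrC => -> /eqP.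
rewrite !ffactn1 -subr_eq0 -mulrBl mulf_eq0 subr_eq0 eqr_nat eq_sym.
by rewrite (negPf km) => /eqP.
Qed.

(** The case j = k, q = p of [ell_eigen], where the derivatives have become constants. *)
Lemma ell_eigen_norm k p c : laguerre_eigen k p -> p^`(k) = c%:P ->
  k`!%:R * ell (p * p) = c ^+ 2 * ell 'X^k.
Proof.
move=> pk pc; rewrite -ffactnn -(ell_eigen _ _ pk) pc -ellZ.
by congr ell; rewrite -mul_polyC expr2 polyCM; ring.
Qed.

(** The falling factorial of [ell_eigen] divided by r! is a binomial coefficient, so the term r
    contributes C(k, r) tau^r ell(p q), and the binomial theorem sums these. Terms with r > k
    vanish. *)
Lemma ell_gdual_eigen tau k p q N : laguerre_eigen k p -> (k < N)%N ->
  ell (gdual tau N p q) = (1 + tau) ^+ k * ell (p * q).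
Proof.
move=> pk kN; rewrite ell_sum exprDn mulr_suml.
rewrite (big_ord_widen N (fun i => 1 ^+ (k - i) * tau ^+ i *+ 'C(k, i) * _) kN).
rewrite [LHS](bigID (fun r : 'I_N => (r < k.+1)%N))/=.
rewrite [X in _ + X]big1 ?addr0.
  apply: eq_bigr => r _.
  rewrite /gdual_term -mulrA mul_polyC ellZ (ell_eigen _ _ pk).
  rewrite expr1n mul1r -bin_ffact natrM -mulr_natr.
  by field; rewrite pnatr_eq0 -lt0n fact_gt0.
move=> r; rewrite ltnS -ltnNge => kr.
rewrite /gdual_term -mulrA mul_polyC ellZ (ell_eigen _ _ pk).
by rewrite ffact_small// mul0r mulr0.
Qed.

End orthogonality.

(** * Linear functionals given by their moments *)

Section moment_functional.
Context {K : numFieldType} (m : nat -> K).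

Definition mfun (p : {poly K}) : K := \sum_(i < size p) p`_i * m i.

Lemma mfunE n (p : {poly K}) : (size p <= n)%N ->
  mfun p = \sum_(i < n) p`_i * m i.
Proof.
move=> pn; rewrite /mfun (big_ord_widen n (fun i => p`_i * m i) pn).
rewrite [RHS](bigID (fun i : 'I_n => (i < size p)%N))/= [X in _ + X]big1 ?addr0//.
by move=> i; rewrite -leqNgt => pi; rewrite nth_default// mul0r.
Qed.

Lemma mfunD : {morph mfun : p q / p + q}.
Proof.
move=> p q; pose n := maxn (size p) (size q).
rewrite (@mfunE n (p + q)) ?size_polyD// (@mfunE n p) ?leq_maxl//.
rewrite (@mfunE n q) ?leq_maxr// -big_split; apply: eq_bigr => i _ /=.
by rewrite coefD mulrDl.
Qed.

Lemma mfunZ c p : mfun (c *: p) = c * mfun p.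
Proof.
rewrite (mfunE (size_scale_leq c p)) /mfun mulr_sumr; apply: eq_bigr => i _.
by rewrite coefZ mulrA.
Qed.

Lemma mfunXn k : mfun 'X^k = m k.
Proof.
rewrite /mfun size_polyXn big_ord_recr/= big1 ?add0r.
  by rewrite coefXn eqxx mul1r.
by move=> i _; rewrite coefXn ltn_eqF ?mul0r.
Qed.

Lemma poly_sumXn (p : {poly K}) : p = \sum_(i < size p) p`_i *: 'X^i.
Proof. by rewrite -poly_def coefK. Qed.

(** By linearity it suffices to take p = 'X^i, where the argument is (i + a + 1) 'X^i - 'X^(i+1);
    the moment recurrence sends it to 0. *)
Lemma mfun_deriv a : (forall i, m i.+1 = (a + i%:R + 1) * m i) ->
  forall p, mfun ('X * p^`() + (a + 1)%:P * p - 'X * p) = 0.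
Proof.
move=> mS p; pose D (p : {poly K}) := 'X * p^`() + (a + 1)%:P * p - 'X * p.
have DD : {morph D : p q / p + q} by move=> q r; rewrite /D derivD; ring.
have D0 : D 0 = 0 by rewrite /D deriv0; ring.
rewrite -/(D p) (poly_sumXn p) (big_morph D DD D0).
rewrite (big_morph mfun mfunD (ell0 mfunZ)); apply: big1 => i _.
have -> : D (p`_i *: 'X^i) = p`_i *: ((i%:R + a + 1) *: 'X^i + (- 1) *: 'X^(i.+1)).
  rewrite /D derivZ derivXn exprS -!mul_polyC -mulr_natr !polyCD polyCN polyC1.
  rewrite polyC_natr; case: (nat_of_ord i) => [|j]; rewrite ?expr0 ?succnK ?exprS; ring.
by rewrite mfunZ mfunD !mfunZ !mfunXn mS; ring.
Qed.

End moment_functional.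

(** * Integrals over the real line *)

Section whole_line.
Context {R : realType}.
Local Notation mu := (@lebesgue_measure R).

Lemma near_itv_symm (x : R) : \forall n \near \oo, x \in `[- n.+1%:R, n.+1%:R].
Proof.
near=> n; rewrite in_itv/= -ler_norml.
apply: (@le_trans _ _ n%:R); last by rewrite ler_nat.
by near: n; exact: nbhs_infty_ger.
Unshelve. all: by end_near. Qed.

(** Dominated convergence with |f| as the bound. The endpoint n + 1 keeps every interval
    nondegenerate, as the fundamental theorem of calculus will require. *)
Lemma cvg_integral_itv_symm (f : R -> R) : mu.-integrable setT (EFin \o f) ->
  (\int[mu]_(x in `[(- n.+1%:R)%R, n.+1%:R%R]) (f x)%:E @[n --> \oo] -->
  \int[mu]_x (f x)%:E)%E.
Proof.
move=> fi.
have mf := measurable_int mu fi.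
pose D n : set R := [set` `[- n.+1%:R, n.+1%:R]].
pose f_ n : R -> \bar R := EFin \o (f \_ (D n)).
have mf_ n : measurable_fun [set: R] (f_ n).
  rewrite /f_ -restrict_EFin; apply/(measurable_restrictT _ _).1.
    exact: measurable_itv.
  by apply: measurable_funTS; exact: mf.
have [] := @dominated_convergence _ _ _ mu setT measurableT f_ (EFin \o f)
  (fun x => `|(f x)%:E|%E) mf_ mf.
- apply: aeW => x _; apply: cvg_near_cst.
  near=> n; rewrite /f_/= patchE ifT// inE/=.
  by near: n; exact: near_itv_symm.
- exact: integrable_abse.
- apply: aeW => x n _; rewrite /f_/= patchE; case: ifP => //= _.
  by rewrite normr0 lee_fin.
move=> _ _; apply: cvg_trans; apply: near_eq_cvg.
by near=> n; rewrite [RHS]integral_mkcond restrict_EFin.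
Unshelve. all: by end_near. Qed.

(** The bound on x F(x) makes F(n) and F(-n) of order 1/n, so the boundary terms of the fundamental
    theorem of calculus on [-n, n] tend to 0. *)
Lemma integralT_derive_eq0 (F f : R -> R) (C : R) :
  (forall x : R, is_derive x 1 F (f x)) -> continuous f ->
  mu.-integrable setT (EFin \o f) -> (forall x, `|x * F x| <= C) ->
  \int[mu]_x f x = 0.
Proof.
move=> dF cf fi FC.
have cF : continuous F.
  move=> x; apply/differentiable_continuous/derivable1_diffP.
  by have [] := dF x.
have FTC n : (\int[mu]_(x in `[(- n.+1%:R)%R, n.+1%:R%R]) (f x)%:E =
    (F n.+1%:R)%:E - (F (- n.+1%:R))%:E)%E.
  apply: continuous_FTC2.
  - by rewrite gtrN// ltr0n.
  - exact: continuous_subspaceT.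
  - split; first by move=> x _; have [] := dF x.
    + by apply: cvg_at_right_filter; exact: cF.
    + by apply: cvg_at_left_filter; exact: cF.
  - by move=> x _; rewrite derive1E; apply: derive_val.
have C0 : 0 <= C by rewrite (le_trans _ (FC 0)).
(* The two values of [e] treat both endpoints at once. *)
have F0 (e : R) : e = 1 \/ e = -1 -> F (e * n.+1%:R) @[n --> \oo] --> 0.
  move=> e1; apply/norm_cvg0P.
  apply: (@squeeze_cvgr _ _ _ _ (cst 0) (fun n => C * n.+1%:R^-1)).
  - near=> n; rewrite normr_ge0/= ler_pdivlMr ?ltr0n//.
    rewrite (le_trans _ (FC (e * n.+1%:R)))// !normrM [`|n.+1%:R|]ger0_norm//.
    have -> : `|e| = 1 by case: e1 => ->; rewrite ?normrN normr1.
    by rewrite mul1r mulrC.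
  - exact: cvg_cst.
  - rewrite -[X in _ --> X](mulr0 C); apply: cvgM; first exact: cvg_cst.
    exact: cvg_harmonic.
have := cvg_integral_itv_symm fi.
under eq_fun do rewrite FTC.
move=> h.
have h0 : ((F n.+1%:R)%:E - (F (- n.+1%:R))%:E)%E @[n --> \oo] --> 0%E.
  have -> : 0%E = (0 - 0 : R)%:E by rewrite subr0.
  apply: cvg_EFin; first by near=> n.
  apply: cvgB.
    by have := F0 1 (or_introl erefl); under eq_fun do rewrite mul1r.
  by have := F0 (-1) (or_intror erefl); under eq_fun do rewrite mulN1r.
by rewrite /Rintegral -(cvg_unique _ h0 h).
Unshelve. all: by end_near. Qed.

End whole_line.

(** * One-dimensional Gaussian integrals *)

Section gaussian.
Context {R : realType}.
Local Notation mu := (@lebesgue_measure R).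

Definition gaussian (a t x : R) : R := expR (- (a * (x - t) ^+ 2)).

Lemma gaussian_ge0 (a t x : R) : 0 <= gaussian a t x.
Proof. exact: expR_ge0. Qed.

(** The normal density of variance 1/(2a) times the total mass sqrt(pi / a), so integrability and
    total integral come from the normal law. *)
Lemma gaussianE (a t x : R) : 0 < a -> gaussian a t x =
  Num.sqrt (pi / a) * normal_pdf t (Num.sqrt (2 * a)^-1) x.
Proof.
move=> a0; set s := Num.sqrt (2 * a)^-1.
have a20 : 0 < (2 * a)^-1 :> R by rewrite invr_gt0 mulr_gt0.
have s0 : s != 0 by rewrite gt_eqF// sqrtr_gt0.
have s2 : s ^+ 2 = (2 * a)^-1 by rewrite sqr_sqrtr ?ltW.
rewrite normal_pdfE// /normal_peak /normal_fun s2.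
have -> : (2 * a)^-1 * pi *+ 2 = pi / a by field; rewrite gt_eqF.
rewrite mulrA divff ?mul1r; last by rewrite gt_eqF// sqrtr_gt0 divr_gt0// pi_gt0.
by congr expR; field; rewrite gt_eqF.
Qed.

Lemma integrable_gaussian (a t : R) : 0 < a ->
  mu.-integrable setT (EFin \o gaussian a t).
Proof.
move=> a0; have -> : EFin \o gaussian a t = (fun x => (Num.sqrt (pi / a))%:E *
    (normal_pdf t (Num.sqrt (2 * a)^-1) x)%:E)%E.
  by apply/funext => x /=; rewrite gaussianE.
by apply: integrableZl => //; exact: integrable_normal_pdf.
Qed.

Lemma Rintegral_gaussian (a t : R) : 0 < a ->
  \int[mu]_x gaussian a t x = Num.sqrt (pi / a).
Proof.
move=> a0; under eq_Rintegral do rewrite gaussianE//.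
rewrite RintegralZl//; last exact: integrable_normal_pdf.
by rewrite /Rintegral integral_normal_pdf mulr1.
Qed.

Lemma pow_le_expR n (x : R) : `|x| ^+ n <= n`!%:R * expR `|x|.
Proof.
case: n => [|n].
  by rewrite expr0 mul1r -expR0 ler_expR.
rewrite mulrC -ler_pdivrMr ?ltr0n ?fact_gt0//.
by apply: le_trans (expR_ge1Dxn n (normr_ge0 x)); rewrite lerDr.
Qed.

Lemma gaussian_pow_bound (a t : R) n : 0 < a -> exists2 C, 0 <= C &
  forall x, `|x ^+ n * gaussian a t x| <= C * gaussian (a / 2) t x.
Proof.
(* With w = |x - t|, one has |x|^n <= n! e^|x|, |x| <= |t| + w and w <= a w^2 / 2 + 1/(2a); the last
   bound costs half of the Gaussian exponent. *)
move=> a0; exists (n`!%:R * expR (`|t| + (2 * a)^-1)).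
  by rewrite mulr_ge0// expR_ge0.
move=> x; rewrite normrM normrX [`|gaussian _ _ _|]ger0_norm ?gaussian_ge0//.
apply: le_trans (ler_wpM2r (gaussian_ge0 _ _ _) (pow_le_expR n x)) _.
rewrite -!mulrA ler_wpM2l// /gaussian -!expRD ler_expR.
have xt : `|x| <= `|t| + `|x - t| by rewrite -{1}(subrK t x) addrC ler_normD.
rewrite -(real_normK (num_real (x - t))).
set w := `|x - t| in xt *.
have : 0 <= (a * w - 1) ^+ 2 / (2 * a) by rewrite divr_ge0 ?sqr_ge0// mulr_ge0 ?ltW.
have -> : (a * w - 1) ^+ 2 / (2 * a) = a / 2 * w ^+ 2 - w + (2 * a)^-1.
  by field; rewrite gt_eqF.
by move: xt; lra.
Qed.

Lemma is_derive_pow_gaussian (a t : R) n (x : R) :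
  is_derive x 1 (fun x => x ^+ n * gaussian a t x)
  (n%:R * (x ^+ n.-1 * gaussian a t x) +
   ((2 * a * t) * (x ^+ n * gaussian a t x) +
    (- (2 * a)) * (x ^+ n.+1 * gaussian a t x))).
Proof.
have dq : is_derive x 1 (fun x : R => - (a * (x - t) ^+ 2)) (- (2 * a * (x - t))).
  apply: (is_derive_eq (f := - (cst a * (id - cst t) ^+ 2))).
  by rewrite /GRing.scale/= !(fctE, mulr0, subr0, addr0, mulr1); ring.
have dg : is_derive x 1 (gaussian a t) (- (2 * a * (x - t)) * gaussian a t x).
  apply: (is_derive_eq (is_derive1_comp (f := expR) (is_derive_expR _) dq)).
  by rewrite /GRing.scale/= mulrC.
have -> : (fun x : R => x ^+ n * gaussian a t x) = id ^+ n * gaussian a t.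
  by apply/funext => y; rewrite [RHS]/(_ * _)/= exprfctE.
apply: is_derive_eq; rewrite /GRing.scale/= exprfctE exprS.
case: n => [|n]; rewrite /= ?exprS. all: ring.
Qed.

Lemma continuous_pow_gaussian (a t : R) n :
  continuous (fun x : R => x ^+ n * gaussian a t x).
Proof.
move=> x; apply/differentiable_continuous/derivable1_diffP.
by have [] := is_derive_pow_gaussian a t n x.
Qed.

Lemma integrable_pow_gaussian (a t : R) n : 0 < a ->
  mu.-integrable setT (fun x => (x ^+ n * gaussian a t x)%:E).
Proof.
move=> a0; have [C C0 CP] := gaussian_pow_bound t n a0.
have a2 : 0 < a / 2 by rewrite divr_gt0.
have := integrableZl measurableT C (integrable_gaussian t a2).
apply: le_integrable => //.
- apply/measurable_EFinP; apply: continuous_measurable_fun.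
  exact: continuous_pow_gaussian.
- move=> x _; rewrite /= lee_fin (le_trans (CP x))// ler_norm//.
Qed.

(** The derivative of x^n times the Gaussian integrates to 0; the identity is solved for the highest
    moment. *)
Lemma Rintegral_pow_gaussianS (a t : R) n : 0 < a ->
  \int[mu]_x (x ^+ n.+1 * gaussian a t x) =
  t * \int[mu]_x (x ^+ n * gaussian a t x) +
  n%:R / (2 * a) * \int[mu]_x (x ^+ n.-1 * gaussian a t x).
Proof.
move=> a0; pose f (x : R) := n%:R * (x ^+ n.-1 * gaussian a t x) +
  ((2 * a * t) * (x ^+ n * gaussian a t x)
   + (- (2 * a)) * (x ^+ n.+1 * gaussian a t x)).
have ig m := integrable_pow_gaussian t m a0.
have ccg (c : R) m : continuous (fun x : R => c * (x ^+ m * gaussian a t x)).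
  by move=> x; exact: (cvgM (cvg_cst c) (@continuous_pow_gaussian a t m x)).
have cig (c : R) m : mu.-integrable setT
   (EFin \o (fun x => c * (x ^+ m * gaussian a t x))).
  have -> : EFin \o (fun x => c * (x ^+ m * gaussian a t x)) =
     (fun x => c%:E * (x ^+ m * gaussian a t x)%:E)%E by [].
  exact: integrableZl.
have : \int[mu]_x f x = 0.
  have [C C0 CP] := gaussian_pow_bound t n.+1 a0.
  apply: (@integralT_derive_eq0 _ (fun x => x ^+ n * gaussian a t x) _ C).
  - exact: is_derive_pow_gaussian.
  - by move=> x; exact: (cvgD (ccg _ _ x) (cvgD (ccg _ _ x) (ccg _ _ x))).
  - pose g (c : R) m (x : R) : R := c * (x ^+ m * gaussian a t x).
    have -> : EFin \o f = ((EFin \o g n%:R%R n.-1) \+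
        ((EFin \o g (2 * a * t)%R n) \+ (EFin \o g (- (2 * a))%R n.+1)))%E by [].
    apply: integrableD => //; first exact: cig.
    by apply: integrableD => //; exact: cig.
  - move=> x; rewrite mulrA -exprS (le_trans (CP x))// ler_piMr//.
    by rewrite /gaussian -expR0 ler_expR oppr_le0 mulr_ge0 ?sqr_ge0// divr_ge0// ltW.
rewrite RintegralD//; last exact: (integrableD measurableT (cig _ _) (cig _ _)).
rewrite RintegralD//.
rewrite !RintegralZl; do ?[exact: ig|exact: measurableT]; move=> e.
set I1 := \int[mu]_x (x ^+ n.+1 * _) in e *.
set I0 := \int[mu]_x (x ^+ n * _) in e *.
set Im := \int[mu]_x (x ^+ n.-1 * _) in e *.
have a2 : 2 * a != 0 by rewrite gt_eqF// mulr_gt0.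
apply: (mulfI a2).
have -> : 2 * a * I1 = 2 * a * I1 + (n%:R * Im + (2 * a * t * I0 + - (2 * a) * I1)).
  by rewrite e addr0.
by field; rewrite gt_eqF.
Qed.

(** [s.[u]] and [kappa * u] are the mean and the variance at t = u, and sqrt(pi / a) is the total
    mass. *)
Lemma Rintegral_pow_gaussian (a kappa u : R) (s : {poly R}) n : 0 < a ->
  kappa * u = (2 * a)^-1 ->
  \int[mu]_x (x ^+ n * gaussian a s.[u] x) =
  Num.sqrt (pi / a) * (gmom kappa s n).[u].
Proof.
move=> a0 ku.
(* Two consecutive moments are proved together because the recurrence reaches back two steps. *)
suff : \int[mu]_x (x ^+ n * gaussian a s.[u] x) =
    Num.sqrt (pi / a) * (gmom kappa s n).[u] /\
  \int[mu]_x (x ^+ n.+1 * gaussian a s.[u] x) =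
    Num.sqrt (pi / a) * (gmom kappa s n.+1).[u] by case.
have E0 : \int[mu]_x (x ^+ 0 * gaussian a s.[u] x) = Num.sqrt (pi / a).
  by rewrite -(Rintegral_gaussian s.[u] a0); apply: eq_Rintegral => x _; rewrite mul1r.
elim: n => [|n [IH0 IH1]].
  split; first by rewrite E0 hornerE mulr1.
  by rewrite Rintegral_pow_gaussianS// E0 gmomS /= !(mul0r, addr0, mulr1) mulrC.
split=> //; rewrite Rintegral_pow_gaussianS// succnK IH0 IH1 (gmomS _ _ n.+1).
rewrite succnK -[n.+1%:R in RHS]polyC_natr.
by rewrite !(hornerM, hornerD, hornerC, hornerX) -ku; ring.
Qed.

End gaussian.

(** * Exponential integrals and the substitution t = e^u *)

Section exponential_integrals.
Context {R : realType}.
Local Notation mu := (@lebesgue_measure R).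

Lemma is_derive_expRM (a x : R) :
  is_derive x 1 (fun x => expR (a * x)) (a * expR (a * x)).
Proof.
have dl : is_derive x 1 (fun x : R => a * x) a.
  apply: (is_derive_eq (f := cst a * id)).
  by rewrite /GRing.scale/= mulr1 mulr0 addr0.
apply: (is_derive_eq (is_derive1_comp (f := expR) (is_derive_expR _) dl)).
by rewrite /GRing.scale/= mulrC.
Qed.

Lemma is_derive_expRN (x : R) : is_derive x 1 (fun x => expR (- x)) (- expR (- x)).
Proof.
have := is_derive_expRM (-1) x.
by under eq_fun do rewrite mulN1r; rewrite !mulN1r.
Qed.

Lemma is_derive_continuous (f df : R -> R) :
  (forall x : R, is_derive x 1 f (df x)) -> continuous f.
Proof.
move=> fdf x; apply/differentiable_continuous/derivable1_diffP.
by have [] := fdf x.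
Qed.

Lemma integrable_expR_norm (d : R) : 0 < d ->
  mu.-integrable setT (EFin \o (fun x : R => expR (- (d * `|x|)))).
Proof.
move=> d0; have ce : continuous (fun x : R => expR (- (d * `|x|))).
  move=> x; apply: continuous_comp; last exact: continuous_expR.
  apply: continuousN.
  exact: (cvgM (cvg_cst d) (@norm_continuous _ _ x)).
apply/integrableP; split.
  by apply/measurable_EFinP; exact: continuous_measurable_fun.
under eq_integral do rewrite gee0_abs ?lee_fin ?expR_ge0//.
rewrite ge0_symfun_integralT//; last by move=> x /=; rewrite normrN.
rewrite -set_itvcy.
have dF (x : R) : is_derive x 1 (fun x => - d^-1 * expR (- d * x)) (expR (- d * x)).
  apply: (is_derive_eq (is_deriveM (is_derive_cst (- d^-1) x 1) (is_derive_expRM (- d) x))).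
  by rewrite /GRing.scale/=; field; rewrite gt_eqF.
rewrite (@ge0_continuous_FTC2y _ _ (fun x => - d^-1 * expR (- d * x)) 0 0).
- by rewrite mulr0 expR0 -EFinB -EFinM ltry.
- by move=> x _; exact: expR_ge0.
- exact: continuous_subspaceT.
- have -> : 0 = - d^-1 * 0 :> R by rewrite mulr0.
  apply: (@cvgM _ _ _ _ (cst (- d^-1))); first exact: cvg_cst.
  under eq_fun do rewrite mulNr.
  apply: (cvg_comp (fun x => d * x) (fun x => expR (- x))); last exact: cvgr_expR.
  by apply: gt0_cvgMry => //; exact: cvg_id.
- by move=> x _; have [] := dF x.
- by apply: cvg_at_right_filter; apply: (is_derive_continuous dF).
- move=> x; rewrite in_itv/= andbT => x0.
  by rewrite derive1E derive_val ger0_norm ?mulNr// ltW.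
Qed.

(** If the integral is infinite, [fine] reads both sides as 0, so the rule can be applied before
    integrability is known. *)
Lemma ge0_RintegralZl (k : R) (f : R -> R) : 0 < k ->
  measurable_fun setT f -> (forall x, 0 <= f x) ->
  \int[mu]_x (k * f x) = k * \int[mu]_x f x.
Proof.
move=> k0 mf f0; rewrite /Rintegral.
under eq_integral do rewrite EFinM.
rewrite ge0_integralZl_EFin//; last 3 first.
- by move=> x _; rewrite lee_fin.
- exact/measurable_EFinP.
- exact: ltW.
case: (\int[mu]_u _)%E => [z||] //=.
  by rewrite mulry gtr0_sg// mul1e mulr0.
by rewrite mulrNy gtr0_sg// mul1e mulr0.
Qed.

Lemma ge0_integralT_shift (f : R -> R) (c : R) : (forall x, 0 <= f x) ->
  continuous f ->
  (\int[mu]_x (f x)%:E = \int[mu]_x (f (x + c))%:E)%E.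
Proof.
move=> f0 cf.
have d1 (x : R) : is_derive x 1 (fun x => x + c) 1.
  exact: is_derive_shift.
have d1E : ((fun x : R => x + c)^`())%classic = cst 1.
  by apply/funext => x; rewrite derive1E derive_val.
rewrite (@increasing_ge0_integration_by_substitutionT _ (fun x => x + c) f)//.
- by apply: eq_integral => x _; rewrite d1E; congr EFin; exact: mulr1.
- by move=> x y xy; rewrite ltrD2r.
- by rewrite d1E; exact: cst_continuous.
- by rewrite d1E; exact: is_cvg_cst.
- by rewrite d1E; exact: is_cvg_cst.
- apply/cvgrNyPle => A; near=> x; rewrite -lerBrDr.
  by near: x; apply: nbhs_ninfty_le; exact: num_real.
- apply/cvgryPge => A; near=> x; rewrite -lerBlDr.
  by near: x; apply: nbhs_pinfty_ge; exact: num_real.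
Unshelve. all: by end_near. Qed.

Lemma bigcup_itv_symm : \bigcup_n [set` `[- n.+1%:R, n.+1%:R]] = [set: R].
Proof.
apply/seteqP; split => // x _.
have [N _ NP] := near_itv_symm x; exists N => //.
by apply: NP => /=.
Qed.

Lemma bigcup_itv_expR :
  \bigcup_n [set` `[expR (- n.+1%:R), expR n.+1%:R]] = `]0, +oo[%classic :> set R.
Proof.
apply/seteqP; split => x.
  move=> [n _] /=; rewrite !in_itv/= andbT => /andP[h _].
  exact: lt_le_trans (expR_gt0 _) h.
rewrite /= in_itv/= andbT => x0.
have [N _ NP] := near_itv_symm (ln x); exists N => //=.
have := NP N (leqnn N); rewrite /= !in_itv/=.
by rewrite -{3 4}(lnK x0) !ler_expR.
Qed.

(** Change of variables on the compact intervals [e^(-n), e^n], then monotone convergence as they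
    exhaust the half-line. *)
Lemma ge0_integral_substitution_expR (G : R -> R) :
  (forall x, 0 < x -> 0 <= G x) -> {in `]0, +oo[, continuous G} ->
  (\int[mu]_(x in `]0%R, +oo[) (G x)%:E =
   \int[mu]_x (G (expR x) * expR x)%:E)%E.
Proof.
move=> G0 cG.
have dE : ((@expR R)^`())%classic = expR by apply/funext => x; rewrite derive1E derive_val.
have mono (n m : nat) : (n <= m)%N -> - m.+1%:R <= - n.+1%:R :> R.
  by move=> nm; rewrite lerN2 ler_nat ltnS.
have cGe : continuous (fun x => G (expR x) * expR x).
  move=> x; apply: (@cvgM _ _ _ _ (G \o expR)); last exact: continuous_expR.
  apply: continuous_comp; first exact: continuous_expR.
  by apply: cG; rewrite in_itv/= andbT expR_gt0.
have e n : (\int[mu]_(x in `[expR (- n.+1%:R)%R, expR n.+1%:R%R]) (G x)%:E =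
    \int[mu]_(x in `[(- n.+1%:R)%R, n.+1%:R%R]) (G (expR x) * expR x)%:E)%E.
  rewrite integration_by_substitution_increasing.
  - by rewrite dE.
  - by rewrite (@le_trans _ _ 0)// oppr_le0.
  - by move=> x y _ _; rewrite ltr_expR.
  - by rewrite dE => x _; exact: continuous_expR.
  - by rewrite dE; apply/cvg_ex; eexists; apply: cvg_at_right_filter; exact: continuous_expR.
  - by rewrite dE; apply/cvg_ex; eexists; apply: cvg_at_left_filter; exact: continuous_expR.
  - split.
    + by move=> x _; exact: derivable_expR.
    + by apply: cvg_at_right_filter; exact: continuous_expR.
    + by apply: cvg_at_left_filter; exact: continuous_expR.
  - apply: (@continuous_in_subspaceT _ _ [set` `[expR (- n.+1%:R), expR n.+1%:R]]).
    move=> x; rewrite inE/= in_itv/= => /andP[h _].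
    by apply: cG; rewrite in_itv/= andbT (lt_le_trans _ h)// expR_gt0.
have mG : measurable_fun (`]0, +oo[%classic : set R) G.
  apply: open_continuous_measurable_fun; first exact: interval_open.
  by move=> x; rewrite inE; exact: cG.
pose I n : set (measurableTypeR R) := [set` `[expR (- n.+1%:R), expR n.+1%:R]].
pose J n : set (measurableTypeR R) := [set` `[- n.+1%:R, n.+1%:R]].
have sub n : I n `<=` `]0, +oo[%classic.
  by rewrite -bigcup_itv_expR; exact: (@bigcup_sup _ _ n setT I).
have ndI : nondecreasing_seq I.
  move=> n m nm; apply/subsetPset => x; rewrite /I /= !in_itv/= => /andP[h1 h2].
  rewrite (le_trans _ h1) ?(le_trans h2)// ler_expR ?ler_nat ?mono//.
have ndJ : nondecreasing_seq J.
  move=> n m nm; apply/subsetPset => x; rewrite /J /= !in_itv/= => /andP[h1 h2].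
  by rewrite (le_trans _ h1) ?(le_trans h2)// ?ler_nat ?mono.
have l1 := @ge0_nondecreasing_set_cvg_integral _ (measurableTypeR R) R
  I (EFin \o G) mu ndI.
have l2 := @ge0_nondecreasing_set_cvg_integral _ (measurableTypeR R) R
  J (EFin \o (fun x => G (expR x) * expR x)) mu ndJ.
rewrite -bigcup_itv_expR -bigcup_itv_symm.
have {}l1 := l1 (fun=> measurable_itv _)
  (fun n => (measurable_EFinP _ _).2 (measurable_funS (measurable_itv _) (sub n) mG)).
have {}l2 := l2 (fun=> measurable_itv _)
  (fun n => (measurable_EFinP _ _).2 (measurable_funTS (continuous_measurable_fun cGe))).
have G0' n x : I n x -> (0 <= (EFin \o G) x)%E.
  by move/sub; rewrite /= in_itv/= andbT => x0; rewrite lee_fin; exact: G0.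
have Ge0' n x : J n x -> (0 <= (G (expR x) * expR x)%R%:E)%E.
  by move=> _; rewrite lee_fin mulr_ge0 ?expR_ge0// G0// expR_gt0.
apply: (cvg_unique _ (l1 G0')) => //.
by apply: cvg_trans (l2 Ge0'); apply: near_eq_cvg; near=> n; rewrite -e.
Unshelve. all: by end_near. Qed.

End exponential_integrals.

(** * Euler's integral in the variable u = ln t *)

Section gamma.
Context {R : realType}.
Local Notation mu := (@lebesgue_measure R).

(** Euler's integrand t^(s-1) e^(-t) at t = e^u, times the Jacobian e^u. *)
Definition gamma_fun (s u : R) : R := expR (s * u - expR u).

Lemma gamma_fun_ge0 (s u : R) : 0 <= gamma_fun s u.
Proof. exact: expR_ge0. Qed.

Lemma gamma_fun_bound (s : R) : 0 < s -> exists C d, [/\ 0 < C, 0 < d &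
  forall u, gamma_fun s u <= C * expR (- (d * `|u|))].
Proof.
(* For u >= 0 the tangent to exp at ln (s + 1), of slope s + 1, gives s u - e^u <= (s + 1) ln (s +
   1) - u; for u < 0 the term s u alone decays at rate s. *)
move=> s0; exists (expR ((s + 1) * ln (s + 1))), (Num.min s 1).
have s1 : 0 < s + 1 by rewrite addr_gt0.
have l0 : 0 <= (s + 1) * ln (s + 1).
  by rewrite mulr_ge0 ?ln_ge0 ?ltW// ltrDr.
split; [exact: expR_gt0|by rewrite lt_min s0 ltr01|move=> u].
rewrite /gamma_fun -expRD ler_expR.
have [u0|u0] := leP 0 u.
  have e : (s + 1) * (1 + (u - ln (s + 1))) <= expR u.
    rewrite -{2}(subrK (ln (s + 1)) u) expRD lnK ?posrE// [leRHS]mulrC.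
    by rewrite ler_pM2l// expR_ge1Dx.
  have : Num.min s 1 * u <= u by rewrite ler_piMl// ge_min lexx orbT.
  by rewrite (ger0_norm u0); nra.
have : Num.min s 1 * - u <= s * - u.
  by rewrite ler_wpM2r ?ge_min ?lexx// oppr_ge0 ltW.
by rewrite (ltr0_norm u0); have := expR_ge0 u; lra.
Qed.

Lemma is_derive_gamma_fun (s u : R) :
  is_derive u 1 (gamma_fun s) (s * gamma_fun s u - gamma_fun (s + 1) u).
Proof.
have dl : is_derive u 1 (fun u => s * u - expR u) (s - expR u).
  apply: (is_derive_eq (f := cst s * id - expR)).
  by rewrite /GRing.scale/= mulr1 mulr0 addr0.
apply: (is_derive_eq (is_derive1_comp (f := expR) (is_derive_expR _) dl)).
rewrite /GRing.scale/= /gamma_fun.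
have -> : (s + 1) * u - expR u = u + (s * u - expR u) by ring.
by rewrite expRD; ring.
Qed.

Lemma continuous_gamma_fun (s : R) : continuous (gamma_fun s).
Proof. exact: is_derive_continuous (is_derive_gamma_fun s). Qed.

Lemma integrable_gamma_fun (s : R) : 0 < s ->
  mu.-integrable setT (EFin \o gamma_fun s).
Proof.
move=> s0; have [C [d [C0 d0 bnd]]] := gamma_fun_bound s0.
have := integrableZl measurableT C (integrable_expR_norm d0).
apply: le_integrable => //.
- apply/measurable_EFinP; apply: continuous_measurable_fun.
  exact: continuous_gamma_fun.
- move=> u _ /=; rewrite lee_fin ger0_norm ?gamma_fun_ge0// (le_trans (bnd u))//.
  exact: ler_norm.
Qed.

Definition gamma_exp (s : R) : R := \int[mu]_u gamma_fun s u.

(** Functional equation of Gamma: the derivative of [gamma_fun s] integrates to 0. *)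
Lemma gamma_expS (s : R) : 0 < s -> gamma_exp (s + 1) = s * gamma_exp s.
Proof.
move=> s0; have s1 : 0 < s + 1 by rewrite addr_gt0.
have sI : mu.-integrable setT (EFin \o (fun u => s * gamma_fun s u)).
  have -> : EFin \o (fun u => s * gamma_fun s u) =
     (fun u => s%:E * (EFin \o gamma_fun s) u)%E by [].
  exact: (integrableZl measurableT s (integrable_gamma_fun s0)).
have sJ := integrable_gamma_fun s1.
have : \int[mu]_u (s * gamma_fun s u - gamma_fun (s + 1) u) = 0.
  have [C [d [C0 d0 bnd]]] := gamma_fun_bound s0.
  (* The constant comes from d |u| exp(-d |u|) <= 1. *)
  apply: (integralT_derive_eq0 (F := gamma_fun s) (C := C / d)).
  - exact: is_derive_gamma_fun.
  - move=> u; apply: cvgB; last exact: continuous_gamma_fun.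
    exact: (cvgM (cvg_cst s) (@continuous_gamma_fun s u)).
  - exact: (integrableB measurableT sI sJ).
  - move=> u; rewrite normrM (ger0_norm (gamma_fun_ge0 s u)).
    rewrite (le_trans (ler_wpM2l (normr_ge0 u) (bnd u)))//.
    rewrite mulrCA ler_pM2l// expRN ler_pdivrMr ?expR_gt0// -ler_pdivrMl ?invr_gt0//.
    by rewrite invrK (le_trans _ (expR_ge1Dx _))// lerDr.
rewrite RintegralB// RintegralZl//; last exact: integrable_gamma_fun.
by move/eqP; rewrite subr_eq0 => /eqP.
Qed.

Lemma Gamma_gamma_exp (s : R) : Gamma s = gamma_exp s.
Proof.
rewrite /Gamma /gamma_exp /Rintegral; congr fine.
rewrite (ge0_integral_substitution_expR (G := fun t => t `^ (s - 1) * expR (- t))).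
- apply: eq_integral => u _; congr EFin.
  by rewrite -expRM mulrAC -!expRD /gamma_fun; congr expR; ring.
- by move=> x x0; rewrite mulr_ge0 ?powR_ge0 ?expR_ge0.
- move=> x; rewrite in_itv/= andbT => x0.
  apply: differentiable_continuous; apply/derivable1_diffP.
  apply: derivableM; last by apply: ex_derive.
  by have [] := is_derive1_powR (s - 1) x0.
Qed.

End gamma.

(** * The Macdonald function as an integral over the line *)

Section bessel.
Context {R : realType}.
Local Notation mu := (@lebesgue_measure R).

Lemma ge0_integralT_fold (f : R -> R) : (forall x, 0 <= f x) -> continuous f ->
  (\int[mu]_x (f x)%:E =
   \int[mu]_(x in `[0%R, +oo[) (f x)%:E + \int[mu]_(x in `[0%R, +oo[) (f (- x)%R)%:E)%E.
Proof.
move=> f0 cf; have mf : measurable_fun setT f by exact: continuous_measurable_fun.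
have -> : (\int[mu]_(x in `[0%R, +oo[) (f (- x)%R)%:E =
    \int[mu]_(x in `]-oo, 0%R]) (f x)%:E)%E.
  rewrite -[in RHS]oppr0 ge0_integration_by_substitutionNy//.
  exact: continuous_subspaceT.
rewrite -integral_itv_obnd_cbnd; last first.
  by apply/measurable_EFinP/measurable_funTS.
rewrite -ge0_integral_setU//=.
- by rewrite -setCitvl setUC setUv.
- by rewrite -setCitvl setUC setUv; apply/measurable_EFinP.
- by move=> x _; rewrite lee_fin.
- rewrite disj_set2E; apply/eqP; rewrite -subset0 => x/=.
  by rewrite !in_itv/= andbT ltNge => -[/negP].
Qed.

Lemma continuous_cosh : continuous (@cosh R).
Proof.
apply: (@is_derive_continuous _ _ (fun t => (expR t - expR (- t)) / 2)) => t.
have dN := is_derive_expRN t.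
have -> : @cosh R = (expR + (fun t => expR (- t))) * cst 2^-1 by [].
apply: is_derive_eq; rewrite /GRing.scale/= mulr0 add0r; exact: mulrC.
Qed.

(** cosh(nu t) is the mean of exp(nu t) and exp(-nu t); the reflection t -> -t, which fixes
    [cosh t], carries the second to the negative half-line. *)
Lemma besselK_integrand_fold (nu x : R) :
  (\int[mu]_(t in `[0%R, +oo[) (expR (- (x * cosh t)) * cosh (nu * t))%:E =
   \int[mu]_t (2^-1 * expR (nu * t - x * cosh t))%:E)%E.
Proof.
have cE : continuous (fun t : R => expR (nu * t - x * cosh t)).
  move=> t; apply: continuous_comp; last exact: continuous_expR.
  apply: cvgB; first exact: (cvgM (cvg_cst nu) (@cvg_id _ _)).
  exact: (cvgM (cvg_cst x) (@continuous_cosh t)).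
have c2E : continuous (fun t : R => 2^-1 * expR (nu * t - x * cosh t)).
  by move=> t; exact: (cvgM (cvg_cst _) (cE t)).
rewrite ge0_integralT_fold//.
rewrite -ge0_integralD//; last 2 first.
- by apply/measurable_EFinP; apply: measurable_funTS; exact: continuous_measurable_fun.
- apply/measurable_EFinP; apply: measurable_funTS; apply: continuous_measurable_fun.
  move=> t; apply: (continuous_comp (f := -%R) (g := fun t => 2^-1 * expR (nu * t - x * cosh t))).
    exact: opp_continuous.
  exact: c2E.
apply: eq_integral => t _; rewrite -EFinD; congr EFin.
rewrite /cosh opprK [expR (- t) + _]addrC mulrN !expRD.
by field.
Qed.

(* Shifting the integration variable of K_nu by ln (a / r) makes the exponent
   quadratic in r, hence Gaussian in the plane variable. *)
Lemma powR_besselK (nu a b r : R) : 0 < a -> 0 < r ->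
  r `^ nu * besselK nu (2 * (b * a) * r) =
  \int[mu]_u (a `^ nu / 2 *
    expR (nu * u - b * a ^+ 2 * expR u - b * r ^+ 2 * expR (- u))).
Proof.
move=> a0 r0; rewrite /besselK /Rintegral besselK_integrand_fold.
set E := fun t : R => 2^-1 * expR (nu * t - 2 * (b * a) * r * cosh t).
have cE : continuous E.
  move=> t; apply: (cvgM (cvg_cst _)); apply: continuous_comp; last exact: continuous_expR.
  apply: cvgB; first exact: (cvgM (cvg_cst nu) (@cvg_id _ _)).
  exact: (cvgM (cvg_cst _) (@continuous_cosh t)).
have E0 t : 0 <= E t by rewrite mulr_ge0 ?expR_ge0.
rewrite (@ge0_integralT_shift _ E (ln (a / r)))//.
have ar : 0 < a / r by rewrite divr_gt0.
have rnu : 0 < r `^ nu by rewrite powR_gt0.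
rewrite -[fine _]/(\int[mu]_u E (u + ln (a / r))) -ge0_RintegralZl//; last first.
  apply: continuous_measurable_fun => t.
  apply: (continuous_comp (f := fun t => t + ln (a / r)) (g := E)); last exact: cE.
  by apply: cvgD; [exact: cvg_id|exact: cvg_cst].
apply: eq_Rintegral => u _.
have aE : a `^ nu = r `^ nu * expR (nu * ln (a / r)).
  have -> : expR (nu * ln (a / r)) = (a / r) `^ nu by rewrite /powR gt_eqF.
  by rewrite -powRM ?ltW// mulrCA divff ?mulr1// gt_eqF.
rewrite /E /cosh aE; set L := ln (a / r).
have -> : nu * (u + L) - 2 * (b * a) * r * ((expR (u + L) + expR (- (u + L))) / 2) =
    nu * L + (nu * u - b * a ^+ 2 * expR u - b * r ^+ 2 * expR (- u)).
  rewrite opprD !expRD -(lnV ar) !lnK ?posrE ?invr_gt0//.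
  by field; rewrite !gt_eqF.
by rewrite expRD; field.
Qed.

End bessel.

(** * Integrals over the plane *)

Section product_integrals.
Context {R : realType}.
Local Notation mu := (@lebesgue_measure R).
Local Notation area := (mu \x mu)%E.

Lemma measurable_funT1 (f : R -> R) : measurable_fun setT f ->
  measurable_fun setT (fun p : R * R => f p.1).
Proof. by move=> mf; apply: measurableT_comp. Qed.

Lemma measurable_funT2 (f : R -> R) : measurable_fun setT f ->
  measurable_fun setT (fun p : R * R => f p.2).
Proof. by move=> mf; apply: measurableT_comp. Qed.

Lemma measurable_funT12 (f g : R -> R) : measurable_fun setT f ->
  measurable_fun setT g -> measurable_fun setT (fun p : R * R => f p.1 * g p.2).
Proof.
by move=> mf mg; apply: measurable_funM; [exact: measurable_funT1|exact: measurable_funT2].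
Qed.

Lemma integrable_prodM (f g : R -> R) :
  mu.-integrable setT (EFin \o f) -> mu.-integrable setT (EFin \o g) ->
  area.-integrable setT (fun p => (f p.1 * g p.2)%:E).
Proof.
move=> fi gi.
have mf : measurable_fun setT f by apply/measurable_EFinP; exact: measurable_int fi.
have mg : measurable_fun setT g by apply/measurable_EFinP; exact: measurable_int gi.
apply/integrable12ltyP.
  by apply/measurable_EFinP; exact: measurable_funT12.
have [_ gfin] := integrableP _ _ _ gi.
have [_ ffin] := integrableP _ _ _ fi.
have gf : (\int[mu]_y `|(g y)%:E|)%E \is a fin_num.
  by rewrite ge0_fin_numE ?integral_ge0.
have ff : (\int[mu]_y `|(f y)%:E|)%E \is a fin_num.
  by rewrite ge0_fin_numE ?integral_ge0.
have inner x : (\int[mu]_y `|(f (x, y).1 * g (x, y).2)%:E| =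
    `|(f x)%:E| * \int[mu]_y `|(g y)%:E|)%E.
  rewrite -ge0_integralZl//=; last by apply/measurable_EFinP; exact: measurableT_comp.
  by apply: eq_integral => y _; rewrite normrM EFinM.
under eq_integral do rewrite inner.
rewrite -(fineK gf) ge0_integralZr//=.
- by rewrite -(fineK ff) -EFinM ltry.
- by apply/measurable_EFinP; exact: measurableT_comp.
- by rewrite lee_fin fine_ge0// integral_ge0.
Qed.

Lemma Rintegral_prodM (f g : R -> R) :
  mu.-integrable setT (EFin \o f) -> mu.-integrable setT (EFin \o g) ->
  \int[area]_p (f p.1 * g p.2) = (\int[mu]_x f x) * (\int[mu]_x g x).
Proof.
move=> fi gi; rewrite /Rintegral -integral12_prod_meas1; last exact: integrable_prodM.
rewrite /fubini_F/=.
have inner x : (\int[mu]_y (f (x, y).1 * g (x, y).2)%:E =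
    (f x)%:E * \int[mu]_y (g y)%:E)%E.
  by rewrite -integralZl//; apply: eq_integral => y _; rewrite /= EFinM.
under eq_integral do rewrite inner.
rewrite -(fineK (integrable_fin_num measurableT gi)) integralZr//.
by rewrite fineM// integrable_fin_num.
Qed.

End product_integrals.

(** * Area as a sigma-finite measure *)

Section plane_measure.
Context {R : realType}.
Local Notation mu := (@lebesgue_measure R).

(* An alias: sigma-finiteness of [mu \x mu] itself is not inferred, because the
   instance for finite factors takes precedence. *)
Definition plane_measure : set (measurableTypeR R * measurableTypeR R) -> \bar R :=
  (mu \x mu)%E.

HB.instance Definition _ := Measure.on plane_measure.

Let plane_measure_sigma_finite : sigma_finite setT plane_measure.
Proof.
pose J n : set (measurableTypeR R) := [set` `[- n.+1%:R, n.+1%:R]].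
exists (fun n => J n `*` J n).
  apply/esym; rewrite -subTset => -[x y] _.
  have [N _ NP] := filterI (near_itv_symm x) (near_itv_symm y).
  by exists N => //; have [] := NP N (leqnn N).
move=> n; have mJ : measurable (J n) by exact: measurable_itv.
have Jfin : mu (J n) \is a fin_num.
  by rewrite /J lebesgue_measure_itv/=; case: ifP => _ //; rewrite -EFinB.
split; first exact: measurableX.
have -> : plane_measure (J n `*` J n) = (mu (J n) * mu (J n))%E.
  exact: product_measure1E.
by rewrite -(fineK Jfin) -EFinM ltry.
Qed.

HB.instance Definition _ := Measure_isSigmaFinite.Build _ _ _ plane_measure
  plane_measure_sigma_finite.

Lemma integrable_plane_prodM (f g : R -> R) :
  mu.-integrable setT (EFin \o f) -> mu.-integrable setT (EFin \o g) ->
  plane_measure.-integrable setT (fun p => (f p.1 * g p.2)%:E).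
Proof. exact: integrable_prodM. Qed.

Lemma Rintegral_plane_prodM (f g : R -> R) :
  mu.-integrable setT (EFin \o f) -> mu.-integrable setT (EFin \o g) ->
  \int[plane_measure]_p (f p.1 * g p.2) = (\int[mu]_x f x) * (\int[mu]_x g x).
Proof. exact: Rintegral_prodM. Qed.

End plane_measure.

(** * The superposition of Gaussians and its moments *)

Section gaussian_mixture.
Context {R : realType}.
Local Notation mu := (@lebesgue_measure R).
Local Notation area := (@plane_measure R).
Variables (c nu : R).
Hypotheses (c0 : 0 < c) (nu1 : 0 < nu + 1).
Local Notation kappa := (2 * c)^-1.

(** The i-th moment of t^nu e^(-t) on the positive half-line. *)
Definition gamma_moment (i : nat) : R := gamma_exp (nu + 1 + i%:R).

Lemma gamma_momentS i : gamma_moment i.+1 = (nu + i%:R + 1) * gamma_moment i.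
Proof.
rewrite /gamma_moment -natr1 addrA gamma_expS; last by rewrite ltr_wpDr.
by congr (_ * _); ring.
Qed.

(** Integrability and value are carried together so that both pass to linear combinations; for 'X^i
    the factor e^(i u) shifts the parameter of [gamma_fun] by i. *)
Lemma integrable_horner_gamma (p : {poly R}) :
  mu.-integrable setT (EFin \o (fun u => p.[expR u] * gamma_fun (nu + 1) u)) /\
  \int[mu]_u (p.[expR u] * gamma_fun (nu + 1) u) = mfun gamma_moment p.
Proof.
pose P (p : {poly R}) :=
  mu.-integrable setT (EFin \o (fun u => p.[expR u] * gamma_fun (nu + 1) u)) /\
  \int[mu]_u (p.[expR u] * gamma_fun (nu + 1) u) = mfun gamma_moment p.
have PD q r : P q -> P r -> P (q + r).
  move=> [qi qE] [ri rE].
  have e : (fun u => (q + r).[expR u] * gamma_fun (nu + 1) u) =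
      (fun u => q.[expR u] * gamma_fun (nu + 1) u + r.[expR u] * gamma_fun (nu + 1) u).
    by apply/funext => u; rewrite hornerD mulrDl.
  split; rewrite e; first exact: (integrableD measurableT qi ri).
  by rewrite RintegralD// qE rE mfunD.
have PZ k q : P q -> P (k *: q).
  move=> [qi qE].
  have e : (fun u => (k *: q).[expR u] * gamma_fun (nu + 1) u) =
      (fun u => k * (q.[expR u] * gamma_fun (nu + 1) u)).
    by apply/funext => u; rewrite hornerZ mulrA.
  split; rewrite e; first exact: (integrableZl measurableT k qi).
  by rewrite RintegralZl// qE mfunZ.
have PX i : P 'X^i.
  have e : (fun u => 'X^i.[expR u] * gamma_fun (nu + 1) u) = gamma_fun (nu + 1 + i%:R).
    apply/funext => u; rewrite hornerXn -expRM_natl /gamma_fun -expRD.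
    by congr expR; ring.
  split; rewrite e; first by apply: integrable_gamma_fun; rewrite ltr_wpDr.
  by rewrite mfunXn.
rewrite -/(P p) (poly_sumXn p); apply: big_ind => [| |i _].
- by rewrite -(scale0r 'X^0); exact: PZ.
- exact: PD.
- exact: PZ.
Qed.

(* The superposition at t = e^u; the Jacobian turns t^(nu - 1) into e^(nu u). *)
Definition mixture (p : R * R) (u : R) : R :=
  expR (nu * u - expR u) * (gaussian (c * expR (- u)) (expR u) p.1 *
                            gaussian (c * expR (- u)) 0 p.2).

Lemma mixture_ge0 p u : 0 <= mixture p u.
Proof. by rewrite /mixture mulr_ge0 ?expR_ge0// mulr_ge0 ?gaussian_ge0. Qed.

Definition mixture_pow n l (q : (R * R) * R) : R :=
  q.1.1 ^+ n * q.1.2 ^+ l * mixture q.1 q.2.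

Lemma measurable_mixture_pow n l : measurable_fun setT (mixture_pow n l).
Proof.
have mx : measurable_fun setT (fun q : (R * R) * R => q.1.1).
  by apply: measurableT_comp.
have my : measurable_fun setT (fun q : (R * R) * R => q.1.2).
  by apply: measurableT_comp.
have mu_ : measurable_fun setT (fun q : (R * R) * R => q.2) by exact: measurable_snd.
have mexp (f : (R * R) * R -> R) : measurable_fun setT f ->
    measurable_fun setT (fun q => expR (f q)).
  by move=> mf; apply: measurableT_comp => //; exact: measurable_expR.
have mN (f : (R * R) * R -> R) : measurable_fun setT f ->
    measurable_fun setT (fun q => - f q).
  by move=> mf; apply: measurableT_comp => //; exact: measurable_oppr.
have mc (k : R) : measurable_fun setT (fun q : (R * R) * R => k) by [].
have meu := mexp _ mu_; have meNu := mexp _ (mN _ mu_).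
have mg (f t : (R * R) * R -> R) : measurable_fun setT f -> measurable_fun setT t ->
    measurable_fun setT (fun q : (R * R) * R => gaussian (c * expR (- q.2)) (t q) (f q)).
  move=> mf mt; apply: mexp; apply: mN.
  apply: measurable_funM; first exact: measurable_funM.
  by apply: measurable_funX; exact: measurable_funB.
apply: measurable_funM.
  by apply: measurable_funM; exact: measurable_funX.
apply: measurable_funM.
  by apply: mexp; apply: measurable_funB => //; exact: measurable_funM.
by apply: measurable_funM; exact: mg.
Qed.

(** At fixed u the coordinates separate. The mass pi e^u / c of the planar Gaussian supplies the
    factor e^u that turns exp(nu u - e^u) into [gamma_fun (nu + 1) u]. *)
Lemma integral_mixture_pow1 n l u :
  area.-integrable setT (fun p => (mixture_pow n l (p, u))%:E) /\
  \int[area]_p mixture_pow n l (p, u) =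
  pi / c * ((gmom kappa 'X n * gmom kappa 0 l).[expR u] * gamma_fun (nu + 1) u).
Proof.
pose a := c * expR (- u).
have a0 : 0 < a by rewrite mulr_gt0 ?expR_gt0.
have i1 := integrable_pow_gaussian (expR u) n a0.
have i2 := integrable_pow_gaussian 0 l a0.
pose f (x : R) := x ^+ n * gaussian a (expR u) x.
pose g (x : R) := x ^+ l * gaussian a 0 x.
have e p : mixture_pow n l (p, u) = expR (nu * u - expR u) * (f p.1 * g p.2).
  by rewrite /mixture_pow /mixture /f /g /=; ring.
have fgi := integrable_plane_prodM (f := f) (g := g) i1 i2.
split.
  have -> : (fun p => (mixture_pow n l (p, u))%:E) =
     (fun p => (expR (nu * u - expR u))%:E * (f p.1 * g p.2)%:E)%E.
    by apply/funext => p; rewrite e.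
  exact: integrableZl.
under eq_Rintegral do rewrite e.
rewrite RintegralZl// (Rintegral_plane_prodM (f := f) (g := g))//.
have ka : kappa * expR u = (2 * a)^-1.
  by rewrite /a expRN; field; rewrite !gt_eqF ?expR_gt0.
have := Rintegral_pow_gaussian 'X n a0 ka; rewrite hornerX => ->.
have := Rintegral_pow_gaussian 0 l a0 ka; rewrite horner0 => ->.
have -> : gamma_fun (nu + 1) u = expR (nu * u - expR u) * expR u.
  by rewrite -expRD /gamma_fun; congr expR; ring.
have -> : pi / c * ((gmom kappa 'X n * gmom kappa 0 l).[expR u] *
   (expR (nu * u - expR u) * expR u)) =
   expR (nu * u - expR u) * (pi / a * (gmom kappa 'X n).[expR u] *
      (gmom kappa 0 l).[expR u]).
  rewrite hornerM /a expRN.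
  by field; rewrite !gt_eqF ?expR_gt0.
have S2 : Num.sqrt (pi / a) ^+ 2 = pi / a by rewrite sqr_sqrtr// divr_ge0 ?pi_ge0// ltW.
move: (Num.sqrt (pi / a)) S2 => S <-.
by move: (gmom _ _ n).[_] (gmom _ _ l).[_] (expR _) => A B E; ring.
Qed.

(** Even exponents make the integrand nonnegative, so Tonelli reduces finiteness to the plane
    integral already computed at each u. *)
Lemma integrable_mixture_pow_double n l :
  (area \x mu)%E.-integrable setT (EFin \o mixture_pow n.*2 l.*2).
Proof.
have F0 q : 0 <= mixture_pow n.*2 l.*2 q.
  rewrite /mixture_pow mulr_ge0 ?mixture_ge0// mulr_ge0// exprn_even_ge0//.
    by rewrite odd_double.
  by rewrite odd_double.
have mF : measurable_fun setT (EFin \o mixture_pow n.*2 l.*2).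
  by apply/measurable_EFinP; exact: measurable_mixture_pow.
apply: (@integrable21ltyP _ _ _ _ _ area mu (EFin \o mixture_pow n.*2 l.*2) mF).2.
pose Q := gmom kappa 'X n.*2 * gmom kappa 0 l.*2.
have e u : (\int[area]_p `|(EFin \o mixture_pow n.*2 l.*2) (p, u)| =
    (pi / c)%:E * (Q.[expR u] * gamma_fun (nu + 1) u)%:E)%E.
  have [i iE] := integral_mixture_pow1 n.*2 l.*2 u.
  rewrite -EFinM -iE /Rintegral fineK; last exact: integrable_fin_num.
  by apply: eq_integral => p _; rewrite /= ger0_norm.
under eq_integral do rewrite e.
have [Qi _] := integrable_horner_gamma Q.
have := integrable_fin_num measurableT (integrableZl measurableT (pi / c) Qi).
by rewrite fin_numE ltey => /andP[_].
Qed.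

Lemma norm_pow_le (x : R) n : `|x ^+ n| <= 1 + x ^+ n.*2.
Proof.
rewrite -addnn exprD -expr2 -[X in _ + X]real_normK ?num_real//.
by have := normr_ge0 (x ^+ n); nra.
Qed.

(** The integrand is dominated by (1 + x^(2n)) (1 + y^(2l)) times the mixture, a sum of four even
    cases. *)
Lemma integrable_mixture_pow n l :
  (area \x mu)%E.-integrable setT (EFin \o mixture_pow n l).
Proof.
have i n' l' := integrable_mixture_pow_double n' l'.
have := integrableD measurableT (integrableD measurableT (i 0 0) (i n 0))
          (integrableD measurableT (i 0 l) (i n l)).
apply: le_integrable => //.
  by apply/measurable_EFinP; exact: measurable_mixture_pow.
move=> q _ /=; rewrite lee_fin; apply: le_trans (ler_norm _).
rewrite /mixture_pow normrM (ger0_norm (mixture_ge0 _ _)) -!mulrDl.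
rewrite ler_wpM2r ?mixture_ge0// normrM.
apply: le_trans (ler_pM (normr_ge0 _) (normr_ge0 _) (norm_pow_le _ _) (norm_pow_le _ _)) _.
by rewrite !double0 !expr0; lra.
Qed.

(** Fubini with the plane integrated first and u last. *)
Lemma Rintegral_mixture_pow n l :
  \int[(area \x mu)%E]_q mixture_pow n l q =
  pi / c * mfun gamma_moment (gmom kappa 'X n * gmom kappa 0 l).
Proof.
rewrite /Rintegral -integral21_prod_meas1; last exact: integrable_mixture_pow.
set Q := _ * gmom kappa 0 l.
have [Qi QE] := integrable_horner_gamma Q.
rewrite -QE -RintegralZl// /Rintegral; congr fine.
apply: eq_integral => u _; rewrite /fubini_G.
have [i <-] := integral_mixture_pow1 n l u.
by rewrite /Rintegral fineK//; exact: integrable_fin_num.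
Qed.

End gaussian_mixture.

(** * The Bessel weight and its moments *)

Section bessel_weight.
Context {R : realType}.
Local Notation mu := (@lebesgue_measure R).
Local Notation area := (@plane_measure R).
Variables (theta nu : R).
Hypotheses (theta1 : 1 < theta) (nu1 : -1 < nu).
Local Notation c := ((theta - 1)^-1).

Let theta0 : 0 < theta. Proof. exact: lt_trans theta1. Qed.

Let c0 : 0 < c. Proof. by rewrite invr_gt0 subr_gt0. Qed.

Let nu10 : 0 < nu + 1. Proof. by rewrite -ltrBlDr sub0r. Qed.

(** Spelled so as to be convertible to the real factor of the integrand of the theorem at z = x +
    iy. *)
Definition bessel_weight (p : R * R) : R :=
  expR (2 * p.1 / (theta - 1)) * Normc.normc (p.1 +i* p.2)%C `^ nu *
  besselK nu (2 * Num.sqrt theta * Normc.normc (p.1 +i* p.2)%C / (theta - 1)).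

(** Schlafli's integral, from [powR_besselK] with a = sqrt(theta) and b = c. The origin is excluded
    because [besselK] has no meaning at 0. *)
Lemma bessel_weightE p : p != (0, 0) ->
  bessel_weight p = theta `^ (nu / 2) / 2 * \int[mu]_u mixture c nu p u.
Proof.
case: p => x y p0; rewrite /bessel_weight/=.
set r := Num.sqrt (x ^+ 2 + y ^+ 2).
have r2 : r ^+ 2 = x ^+ 2 + y ^+ 2 by rewrite sqr_sqrtr// addr_ge0// sqr_ge0.
have r0 : 0 < r.
  rewrite sqrtr_gt0 lt_neqAle addr_ge0 ?sqr_ge0// andbT eq_sym.
  by rewrite paddr_eq0 ?sqr_ge0// !sqrf_eq0 -xpair_eqE.
have s0 : 0 < Num.sqrt theta by rewrite sqrtr_gt0.
have -> : 2 * Num.sqrt theta * r / (theta - 1) = 2 * (c * Num.sqrt theta) * r by ring.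
rewrite -mulrA powR_besselK// sqr_sqrtr ?ltW//.
have -> : Num.sqrt theta `^ nu = theta `^ (nu / 2).
  by rewrite -powR12_sqrt ?ltW// -powRrM mulrC.
have mF (f : R -> R) : continuous f -> measurable_fun setT f.
  exact: continuous_measurable_fun.
have cL (k1 k2 k3 : R) : continuous (fun u => k1 * u - k2 * expR u - k3 * expR (- u)).
  apply: (@is_derive_continuous _ _ (fun u => k1 - k2 * expR u + k3 * expR (- u))) => u.
  have dN := is_derive_expRN u.
  apply: (is_derive_eq (f := cst k1 * id - cst k2 * expR - cst k3 * (fun t => expR (- t)))).
  by rewrite /GRing.scale/= !mulr0 !addr0 mulr1; ring.
have k0 : 0 < theta `^ (nu / 2) / 2 by rewrite divr_gt0 ?powR_gt0.
pose h u := nu * u - c * theta * expR u - c * r ^+ 2 * expR (- u).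
have mh : measurable_fun setT (fun u => expR (h u)).
  by apply: mF => u; apply: continuous_comp; [exact: cL|exact: continuous_expR].
rewrite ge0_RintegralZl//.
rewrite mulrCA -ge0_RintegralZl ?expR_gt0//.
(* Completing the square around e^u, the exponents agree because c theta = c + 1. *)
congr (_ * _); apply: eq_Rintegral => u _.
rewrite /mixture /gaussian -!expRD; congr expR.
rewrite /h r2 /= expRN subr0.
by field; rewrite !gt_eqF ?expR_gt0 ?subr_gt0.
Qed.

Lemma plane_measure_set1 (p : R * R) : area [set p] = 0%E.
Proof.
case: p => x y.
have -> : [set (x, y)] = [set x] `*` [set y] :> set (measurableTypeR R * measurableTypeR R).
  by apply/seteqP; split=> -[a b] /= => [[-> ->]//|[-> ->]].
have -> : area ([set x] `*` [set y]) = (mu [set x] * mu [set y])%E.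
  exact: product_measure1E.
by rewrite lebesgue_measure_set1 mul0e.
Qed.

Lemma measurable_set1_prod (p : R * R) :
  measurable ([set p] : set (measurableTypeR R * measurableTypeR R)).
Proof.
case: p => x y.
have -> : [set (x, y)] = [set x] `*` [set y] :> set (measurableTypeR R * measurableTypeR R).
  by apply/seteqP; split=> -[a b] /= => [[-> ->]//|[-> ->]].
exact: measurableX.
Qed.

(** Off the origin the weight is a constant times a partial integral of the mixture, measurable by
    Fubini; on the remaining point any function is measurable. *)
Lemma measurable_bessel_weight :
  measurable_fun [set: measurableTypeR R * measurableTypeR R] bessel_weight.
Proof.
rewrite -(setvU [set (0, 0)]).
apply/measurable_funU.
- by apply: measurableC; exact: measurable_set1_prod.
- exact: measurable_set1_prod.
split; last exact: measurable_fun_set1.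
have i := integrable_mixture_pow c0 nu10 0 0.
have mG := measurable_fubini_F i.
apply: (eq_measurable_fun (fun p => theta `^ (nu / 2) / 2 *
  fine (fubini_F mu (EFin \o mixture_pow c nu 0 0) p))).
  move=> p; rewrite inE => /eqP p0; rewrite bessel_weightE//.
  congr (_ * _); rewrite /Rintegral /fubini_F; congr fine.
  by apply: eq_integral => u _; rewrite /= /mixture_pow !expr0 !mul1r.
apply: measurable_funTS; apply: measurable_funM => //.
by apply: measurableT_comp => //; exact: mG.
Qed.

(** The factor theta^(nu/2) / 2 of Schlafli's integral times the factor pi / c of the Gaussian
    mass. *)
Definition bessel_const : R := theta `^ (nu / 2) * pi * (theta - 1) / 2.

Definition has_Wint (f : R * R -> R) (v : R) : Prop :=
  area.-integrable setT (EFin \o (fun p => f p * bessel_weight p)) /\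
  \int[area]_p (f p * bessel_weight p) = v.

(** Integrating the mixture over u first gives back the weight almost everywhere; Fubini equates
    this with the plane-first order, whose value is known. *)
Lemma has_Wint_pow n l : has_Wint (fun p => p.1 ^+ n * p.2 ^+ l)
  (bessel_const * mfun (gamma_moment nu)
     (gmom ((theta - 1) / 2) 'X n * gmom ((theta - 1) / 2) 0 l)).
Proof.
have i := integrable_mixture_pow c0 nu10 n l.
have i00 := integrable_mixture_pow c0 nu10 0 0.
pose K := theta `^ (nu / 2) / 2.
pose f (p : R * R) := p.1 ^+ n * p.2 ^+ l * bessel_weight p.
have Gi := integrableZl measurableT K (integrable_fubini_F i).
have mf : measurable_fun [set: measurableTypeR R * measurableTypeR R] (EFin \o f).
  apply/measurable_EFinP; apply: measurable_funM; last exact: measurable_bessel_weight.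
  by apply: measurable_funM; apply: measurable_funX.
(* The exceptions lie at the origin and in the null set where the mixture is not integrable in u. *)
have fG : ae_eq area setT (EFin \o f)
    (fun p => K%:E * fubini_F mu (EFin \o mixture_pow c nu n l) p)%E.
  have p0 : {ae area, forall p, p != (0, 0)}.
    exists [set (0, 0)]; split; first exact: measurable_set1_prod.
      exact: plane_measure_set1.
    by move=> p /= /negP; rewrite negbK => /eqP.
  apply: filterS2 (ae_integrable1 i00) p0 => p ip pN0 _.
  rewrite /f /= bessel_weightE// /fubini_F.
  have ip' : mu.-integrable setT (EFin \o mixture c nu p).
    apply: eq_integrable ip => // u _.
    by rewrite /= /mixture_pow !expr0 !mul1r.
  have -> : (\int[mu]_u (EFin \o mixture_pow c nu n l) (p, u) =
     (p.1 ^+ n * p.2 ^+ l)%:E * \int[mu]_u (EFin \o mixture c nu p) u)%E.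
    by rewrite -integralZl//; apply: eq_integral => u _.
  rewrite -(fineK (integrable_fin_num measurableT ip')) -!EFinM; congr EFin.
  by rewrite mulrCA.
have [mG _] := integrableP _ _ _ Gi.
split.
  apply/integrableP; split => //.
  have [_] := integrableP _ _ _ Gi; apply: le_lt_trans.
  rewrite le_eqVlt; apply/orP; left; apply/eqP.
  apply: ge0_ae_eq_integral => //.
  - exact: measurableT_comp.
  - exact: measurableT_comp.
  - by apply: filterS fG => p pE _; rewrite pE.
have -> : \int[area]_p f p = fine (\int[area]_p
    (K%:E * fubini_F mu (EFin \o mixture_pow c nu n l) p))%E.
  by rewrite /Rintegral; congr fine; apply: ae_eq_integral.
rewrite integralZl//; last exact: integrable_fubini_F i.
rewrite integral12_prod_meas1//.
have := Rintegral_mixture_pow c0 nu10 n l; rewrite /Rintegral.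
rewrite -[in (\int[_]_x _)%E](fineK (integrable_fin_num measurableT i)) /= => ->.
have -> : (2 * c)^-1 = (theta - 1) / 2 by field; rewrite gt_eqF// subr_gt0.
rewrite /K /bessel_const.
by field; rewrite gt_eqF// subr_gt0.
Qed.

End bessel_weight.

(** * Complex polynomials *)

Section laguerre_polynomials.
Context {R : realType}.

(** As [rodrigues_poly a j] is j! times the Laguerre polynomial of degree j and parameter a - j,
    this is the classical rule that the derivative of L_(j+1) with parameter b is -L_j with
    parameter b + 1. *)
Lemma deriv_rodrigues_poly (a : R) j :
  (rodrigues_poly a j.+1)^`() = - j.+1%:R * rodrigues_poly a j.
Proof.
elim: j => [|j IH].
  by rewrite /= -polyC1 derivC mulr0 addr0 derivB !derivM !derivC derivX polyC1; ring.
have PS i : rodrigues_poly a i.+1 = (a - i%:R)%:P * rodrigues_poly a i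
    - 'X * rodrigues_poly a i + 'X * (rodrigues_poly a i)^`() by [].
rewrite (PS j.+1) derivD derivB !derivM derivC derivX !mul1r mul0r add0r.
have dn n (p : {poly R}) : (- n%:R * p)^`() = - n%:R * p^`().
  by rewrite !mulNr derivN !mulr_natl derivMn.
rewrite IH dn (PS j) !polyCB !polyC_natr; ring.
Qed.

Lemma laguerre_rodrigues_poly (nu : R) k :
  laguerre nu k = (k`!%:R)^-1 *: rodrigues_poly (k%:R + nu) k.
Proof.
symmetry; apply: laguerre_unique => x x0.
rewrite /rodrigues derive1n_rodrigues// hornerZ addrAC subrr add0r.
rewrite powRN expRN; set P := _.[x].
by field; rewrite !gt_eqF ?expR_gt0 ?powR_gt0 ?ltr0n ?fact_gt0.
Qed.

Lemma derivn_rodrigues_poly (a : R) k :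
  (rodrigues_poly a k)^`(k) = ((- 1) ^+ k * k`!%:R)%:P.
Proof.
elim: k => [|k IH]; first by rewrite derivn0 mul1r polyC1.
rewrite derivSn deriv_rodrigues_poly -polyC_natr -polyCN mul_polyC derivnZ IH.
by rewrite -mul_polyC -polyCM exprS factS natrM; congr _%:P; ring.
Qed.

(** By the derivative rule the polynomial of index k - 1 is -1/k times the derivative of that of
    index k; with this the defining recurrence becomes Laguerre's equation. *)
Lemma rodrigues_poly_eigen (nu : R) k :
  laguerre_eigen nu k (rodrigues_poly (k%:R + nu) k).
Proof.
rewrite /laguerre_eigen; case: k => [|k].
  by rewrite [rodrigues_poly _ _]/= -polyC1 derivnC derivC polyC1; ring.
rewrite !derivSn derivn0 deriv_rodrigues_poly.
rewrite -polyC_natr -polyCN mul_polyC derivZ /= -!mul_polyC.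
by rewrite -natr1 !polyCD !polyCN !polyCD !polyC_natr; ring.
Qed.

Lemma laguerre_eigen_laguerre (nu : R) k : laguerre_eigen nu k (laguerre nu k).
Proof.
rewrite laguerre_rodrigues_poly /laguerre_eigen !derivnZ !derivZ -!mul_polyC.
by rewrite [RHS]mulrCA -rodrigues_poly_eigen; ring.
Qed.

(** Records the leading coefficient (-1)^k / k!, which fixes the norm. *)
Lemma derivn_laguerre (nu : R) k : (laguerre nu k)^`(k) = ((- 1) ^+ k)%:P.
Proof.
rewrite laguerre_rodrigues_poly derivnZ derivn_rodrigues_poly -mul_polyC -polyCM.
by congr _%:P; field; rewrite pnatr_eq0 -lt0n fact_gt0.
Qed.

End laguerre_polynomials.

(** * Complex-valued integrals against the weight *)

Section complex_integrals.
Context {R : realType}.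
Variables (theta nu : R).
Hypotheses (theta1 : 1 < theta) (nu1 : -1 < nu).
Local Notation area := (@plane_measure R).
Local Notation tau := (theta - 1).
Local Notation "x %:CC" := (real_complex R x) (at level 2).
Local Notation ii := ('i%C : R[i]).
Local Notation has_Wint := (has_Wint theta nu).

Lemma eq_has_Wint f g v : f =1 g -> has_Wint f v -> has_Wint g v.
Proof. by move=> /funext ->. Qed.

Lemma has_WintD f g v w : has_Wint f v -> has_Wint g w ->
  has_Wint (fun p => f p + g p) (v + w).
Proof.
move=> [fi fE] [gi gE].
have e : (fun p => (f p + g p) * bessel_weight theta nu p) =
    (fun p => f p * bessel_weight theta nu p + g p * bessel_weight theta nu p).
  by apply/funext => p; rewrite mulrDl.
split; rewrite e; first exact: (integrableD measurableT fi gi).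
by rewrite RintegralD// fE gE.
Qed.

Lemma has_WintZ k f v : has_Wint f v -> has_Wint (fun p => k * f p) (k * v).
Proof.
move=> [fi fE].
have e : (fun p => k * f p * bessel_weight theta nu p) =
    (fun p => k * (f p * bessel_weight theta nu p)).
  by apply/funext => p; rewrite mulrA.
split; rewrite e; first exact: (integrableZl measurableT k fi).
by rewrite RintegralZl// fE.
Qed.

Definition has_WCint (f : R * R -> R[i]) (v : R[i]) : Prop :=
  has_Wint (fun p => complex.Re (f p)) (complex.Re v) /\
  has_Wint (fun p => complex.Im (f p)) (complex.Im v).

Lemma eq_has_WCint f g v : f =1 g -> has_WCint f v -> has_WCint g v.
Proof. by move=> /funext ->. Qed.

Lemma has_WCintD f g v w : has_WCint f v -> has_WCint g w ->
  has_WCint (fun p => f p + g p) (v + w).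
Proof.
case: v w => [v1 v2] [w1 w2] [fr fi] [gr gi]; split.
  apply: eq_has_Wint (has_WintD fr gr) => p.
  by case: (f p) (g p) => [? ?] [? ?].
apply: eq_has_Wint (has_WintD fi gi) => p.
by case: (f p) (g p) => [? ?] [? ?].
Qed.

Lemma has_WCintZ k f v : has_WCint f v -> has_WCint (fun p => k * f p) (k * v).
Proof.
case: k v => [a b] [v1 v2] [fr fi]; split.
  have := has_WintD (has_WintZ a fr) (has_WintZ (- b) fi).
  rewrite /= mulNr; apply: eq_has_Wint => p.
  by case: (f p) => [? ?] /=; rewrite mulNr.
apply: eq_has_Wint (has_WintD (has_WintZ a fi) (has_WintZ b fr)) => p.
by case: (f p) => [? ?].
Qed.

Lemma has_WCint_sum (I : Type) (r : seq I) (f : I -> R * R -> R[i]) (v : I -> R[i]) :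
  (forall i, has_WCint (f i) (v i)) ->
  has_WCint (fun p => \sum_(i <- r) f i p) (\sum_(i <- r) v i).
Proof.
move=> fv; elim: r => [|i r IH].
  rewrite big_nil; have W0 : has_Wint (fun=> 0) 0.
    have E : (fun p => 0 * bessel_weight theta nu p) = cst 0.
      by apply/funext => p; rewrite mul0r.
    split; rewrite E; first exact: (integrable0 area).
    by rewrite /Rintegral integral0.
  by split; apply: eq_has_Wint W0 => p; rewrite big_nil.
rewrite big_cons; apply: eq_has_WCint (has_WCintD (fv i) IH) => p.
by rewrite big_cons.
Qed.

Definition gamma_momentC (i : nat) : R[i] := (gamma_moment nu i)%:CC.

Lemma gamma_momentCS i :
  gamma_momentC i.+1 = (nu%:CC + i%:R + 1) * gamma_momentC i.
Proof.
rewrite /gamma_momentC gamma_momentS ?rmorphM; last by rewrite -ltrBlDr sub0r.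
by congr (_ * _); rewrite !rmorphD/= rmorph_nat rmorph1.
Qed.

Lemma mfun_real_complex (p : {poly R}) :
  mfun gamma_momentC (map_poly (real_complex R) p) = (mfun (gamma_moment nu) p)%:CC.
Proof.
rewrite /mfun size_map_poly rmorph_sum; apply: eq_bigr => i _.
by rewrite coef_map rmorphM.
Qed.

Lemma gmom_real_complex (kappa : R) (s : {poly R}) n :
  map_poly (real_complex R) (gmom kappa s n) =
  gmom (kappa%:CC) (map_poly (real_complex R) s) n.
Proof.
suff : map_poly (real_complex R) (gmom kappa s n) =
  gmom (kappa%:CC) (map_poly (real_complex R) s) n /\
  map_poly (real_complex R) (gmom kappa s n.+1) =
  gmom (kappa%:CC) (map_poly (real_complex R) s) n.+1 by case.
elim: n => [|n [IH0 IH1]]; first by rewrite /= rmorph1 !addr0 !mulr1.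
split=> //; rewrite (gmomS _ s) (gmomS _ (map_poly _ s)) rmorphD !rmorphM/=.
by rewrite map_polyC map_polyX rmorph_nat IH0 IH1.
Qed.

Local Notation kappaC := ((tau / 2)%:CC).
Local Notation C0 := ((bessel_const theta nu)%:CC).

(** Splitting one factor z = x + iy or conj(z) = x - iy at a time follows the recursion of [cmom];
    the base case is a real monomial. *)
Lemma has_WCint_cmom i j n l :
  has_WCint (fun p => (p.1 +i* p.2)%C ^+ i * ((p.1 +i* p.2)^*)%C ^+ j *
                      (p.1 ^+ n * p.2 ^+ l)%:CC)
   (C0 * mfun gamma_momentC (cmom kappaC ii i j n l)).
Proof.
elim: i n l => [|i IHi] n l; last first.
  have := has_WCintD (IHi n.+1 l) (has_WCintZ ii (IHi n l.+1)).
  rewrite cmomSl mfunD mul_polyC mfunZ mulrDr (mulrCA C0).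
  apply: eq_has_WCint => p; set z := (_ +i* _)%C.
  have zE : z = p.1%:CC + ii * p.2%:CC.
    by apply/eqP; rewrite eq_complex /= !(mul0r, mul1r, mulr0, add0r, addr0, subr0) !eqxx.
  rewrite [z ^+ i.+1]exprS [X in X * z ^+ i]zE !rmorphM/= !exprS !rmorphM/=. ring.
elim: j n l => [|j IHj] n l; last first.
  have := has_WCintD (IHj n.+1 l) (has_WCintZ (- ii) (IHj n l.+1)).
  rewrite cmomSr mfunD -mulNr -polyCN mul_polyC mfunZ mulrDr (mulrCA C0).
  apply: eq_has_WCint => p; set z := (p.1 -i* p.2)%C; set w := (_ +i* _)%C.
  have zE : z = p.1%:CC - ii * p.2%:CC.
    by apply/eqP; rewrite eq_complex /= !(mul0r, mul1r, mulr0, add0r, addr0, subr0, oppr0) !eqxx.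
  by rewrite [z ^+ j.+1]exprS [X in X * z ^+ j]zE !rmorphM/= !exprS !rmorphM/=; ring.
have -> : cmom kappaC ii 0 0 n l = map_poly (real_complex R)
   (gmom (tau / 2) 'X n * gmom (tau / 2) 0 l).
  transitivity (map_poly (real_complex R) (gmom (tau / 2) 'X n) *
                map_poly (real_complex R) (gmom (tau / 2) 0 l)).
    by rewrite !gmom_real_complex map_polyX rmorph0.
  by rewrite -rmorphM.
rewrite mfun_real_complex; set M := mfun _ _.
have -> : C0 * M%:CC = (bessel_const theta nu * M)%:CC by rewrite [RHS]rmorphM.
have [wi wE] := has_Wint_pow theta1 nu1 n l.
split.
  by apply: eq_has_Wint (conj wi wE) => p; rewrite !expr0 !mul1r.
(* The imaginary part is zero, obtained as the zero multiple of the same integral. *)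
have := has_WintZ 0 (conj wi wE); rewrite mul0r.
by apply: eq_has_Wint => p; rewrite !expr0 !mul1r mul0r.
Qed.

End complex_integrals.

(** * Sesquilinear integrals of polynomials *)

Section orthogonality_integrals.
Context {R : realType}.
Variables (theta nu : R).
Hypotheses (theta1 : 1 < theta) (nu1 : -1 < nu).
Local Notation "x %:CC" := (real_complex R x) (at level 2).
Local Notation C0 := ((bessel_const theta nu)%:CC).
Local Notation tauC := (2 * ((theta - 1) / 2)%:CC).
Local Notation Wint := (has_WCint theta nu).

Let ii2 : 'i%C * 'i%C = -1 :> R[i].
Proof. by rewrite -expr2 sqr_i. Qed.

(** Both polynomials are expanded in monomials. Since the coefficients of Q are real, conj(Q(z)) is
    Q evaluated at conj(z). *)
Lemma has_WCint_poly (P Q : {poly R[i]}) N : (size P <= N)%N ->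
  (forall j, (Q`_j)^*%C = Q`_j) ->
  Wint (fun p => P.[(p.1 +i* p.2)%C] * ((Q.[(p.1 +i* p.2)%C])^*)%C)
    (C0 * mfun (gamma_momentC nu) (gdual tauC N P Q)).
Proof.
move=> PN Qreal.
(* By bilinearity and [gdualXn], the derivative pairing is the combination of the moments [cmom]
   produced by this expansion. *)
have cx : gdual tauC N P Q =
    \sum_(i < size P) \sum_(j < size Q)
      (P`_i * Q`_j) *: cmom ((theta - 1) / 2)%:CC 'i%C i j 0 0.
  have D0 q : gdual tauC N 0 q = 0 by have := gdualZl tauC N 0 0 q; rewrite !scale0r.
  have D0' q : gdual tauC N q 0 = 0 by have := gdualZr tauC N 0 q 0; rewrite !scale0r.
  rewrite {1}(poly_sumXn P) (big_morph (fun p => gdual tauC N p Q)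
    (fun p q => gdualDl tauC N p q Q) (D0 Q)).
  apply: eq_bigr => i' _; rewrite gdualZl.
  rewrite {1}(poly_sumXn Q) (big_morph (gdual tauC N 'X^i')
    (fun p q => gdualDr tauC N _ p q) (D0' _)) scaler_sumr.
  apply: eq_bigr => j' _; rewrite gdualZr scalerA; congr (_ *: _).
  pose F i j := cmom ((theta - 1) / 2)%:CC 'i%C i j 0 0.
  have F0 j : F 0 j = 'X^j by exact: cmom0_rec.
  have FS i j : F i.+1 j = 'X * F i j + tauC%:P * 'X * (j%:R * F i j.-1).
    exact: cmom_rec.
  by apply: (gdualXn F0 FS); exact: leq_trans (ltn_ord i') PN.
have step i j : Wint (fun p => (P`_i * Q`_j) *
     ((p.1 +i* p.2)%C ^+ i * ((p.1 +i* p.2)^*)%C ^+ j))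
   (C0 * mfun (gamma_momentC nu) ((P`_i * Q`_j) *: cmom ((theta - 1) / 2)%:CC 'i%C i j 0 0)).
  rewrite mfunZ mulrCA; apply: has_WCintZ.
  apply: eq_has_WCint (has_WCint_cmom theta1 nu1 i j 0 0) => p.
  by rewrite !expr0 mulr1 rmorph1 mulr1.
have stepi i := has_WCint_sum (index_enum 'I_(size Q)) (fun j => step i (nat_of_ord j)).
have := has_WCint_sum (index_enum 'I_(size P)) (fun i => stepi (nat_of_ord i)).
rewrite cx (big_morph _ (mfunD _) (ell0 (mfunZ _))) mulr_sumr.
under [X in Wint _ X -> _]eq_bigr do rewrite -mulr_sumr.
under [X in _ -> Wint _ X]eq_bigr do rewrite (big_morph _ (mfunD _) (ell0 (mfunZ _))).
apply: eq_has_WCint => p; rewrite !horner_coef rmorph_sum/= big_distrlr/=.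
apply: eq_bigr => i _; apply: eq_bigr => j _.
by rewrite rmorphM rmorphXn/= Qreal; ring.
Qed.

End orthogonality_integrals.

(** * Classical orthogonality on the half-line *)

Section laguerre_orthogonality.
Context {R : realType}.
Variables (theta nu : R).
Hypotheses (theta1 : 1 < theta) (nu1 : -1 < nu).

Let L k : {poly R[i]} := map_poly (real_complex R) (laguerre nu k).

Lemma laguerreC_eigen k : laguerre_eigen ((nu)%:C)%C k (L k).
Proof.
have := congr1 (map_poly (real_complex R)) (laguerre_eigen_laguerre nu k).
rewrite /laguerre_eigen /L !derivn_map !deriv_map => e.
transitivity (map_poly (real_complex R)
   ('X * (laguerre nu k)^`(2) + ((nu + 1)%:P - 'X) * (laguerre nu k)^`())).
  rewrite [RHS]rmorphD/= !rmorphM/= rmorphB/= map_polyX map_polyC/=.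
  by rewrite [in RHS]rmorphD rmorph1.
by rewrite e rmorphM/= rmorphN/= rmorph_nat.
Qed.

(** Distinct indices have distinct eigenvalues. For k = m the k-th derivative squares to 1, so the
    norm is the k-th moment Gamma(k + nu + 1) over k!. *)
Lemma mfun_laguerreC k m : mfun (gamma_momentC nu) (L k * L m) =
  ((k == m)%:R * (Gamma (k%:R + nu + 1) / k`!%:R))%:C%C.
Proof.
have D := mfunD (gamma_momentC nu); have Z := mfunZ (gamma_momentC nu).
have d := mfun_deriv (gamma_momentCS nu1).
have [<-|km] := eqVneq k m; last first.
  by rewrite mul0r (ell_eigen_orthogonal D Z d (laguerreC_eigen k) (laguerreC_eigen m) km).
have Lk : (L k)^`(k) = ((- 1) ^+ k)%:P.
  rewrite /L derivn_map derivn_laguerre map_polyC/=.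
  by rewrite rmorphXn rmorphN1.
have := ell_eigen_norm D Z d (laguerreC_eigen k) Lk.
rewrite sqrr_sign mul1r mfunXn => e.
have k0 : k`!%:R != 0 :> R[i] by rewrite pnatr_eq0 -lt0n fact_gt0.
apply: (mulfI k0); rewrite e mul1r rmorphM/= mulrCA fmorphV rmorph_nat divff// mulr1.
by rewrite /gamma_momentC /gamma_moment -Gamma_gamma_exp; congr (Gamma _)%:C%C; ring.
Qed.

End laguerre_orthogonality.

(** * Orthogonality of the Laguerre polynomials over the plane *)

Theorem mainTheorem6 (R : realType) (theta nu : R)
    (theta_gt1 : 1 < theta) (nu_gtN1 : -1 < nu) (k m : nat) :
  let F (z : R[i]) : R[i] :=
    laguerreC nu k z * (laguerreC nu m z)^*%C *
    (expR (2 * complex.Re z / (theta - 1)) *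
     Normc.normc z `^ nu *
     besselK nu (2 * Num.sqrt theta * Normc.normc z / (theta - 1)))%:C%C in
  Cintegrable F /\
  (2 * theta `^ (- nu / 2) / (pi * (theta - 1)))%:C%C * Cintegral F =
  ((k == m)%:R * (Gamma (k%:R + nu + 1) * theta ^+ k / k`!%:R))%:C%C.
Proof.
move=> F.
pose L k : {poly R[i]} := map_poly (real_complex R) (laguerre nu k).
have Lreal j : ((L m)`_j)^*%C = (L m)`_j by rewrite coef_map/= oppr0.
(* The truncation order is the maximum of [size (L k)], which makes the derivative expansion
   complete, and k + 1, which makes the binomial sum complete. *)
have [[ri rE] [ji jE]] := has_WCint_poly theta_gt1 nu_gtN1
  (leq_maxl (size (L k)) k.+1) Lreal.
set V := _ * mfun _ _ in rE jE.
have ReM (z : R[i]) (w : R) : complex.Re (z * w%:C%C) = complex.Re z * w.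
  by case: z => a b /=; rewrite mulr0 subr0.
have ImM (z : R[i]) (w : R) : complex.Im (z * w%:C%C) = complex.Im z * w.
  by case: z => a b /=; rewrite mulr0 add0r.
have FRe p : complex.Re (F (p.1 +i* p.2)%C) =
  complex.Re ((L k).[(p.1 +i* p.2)%C] * ((L m).[(p.1 +i* p.2)%C])^*%C) *
  bessel_weight theta nu p by exact: ReM.
have FIm p : complex.Im (F (p.1 +i* p.2)%C) =
  complex.Im ((L k).[(p.1 +i* p.2)%C] * ((L m).[(p.1 +i* p.2)%C])^*%C) *
  bessel_weight theta nu p by exact: ImM.
split.
  split.
    by under eq_fun do rewrite FRe; exact: ri.
  by under eq_fun do rewrite FIm; exact: ji.
have -> : Cintegral F = V.
  rewrite /Cintegral; under eq_Rintegral do rewrite FRe.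
  under [X in (_ +i* X)%C]eq_Rintegral do rewrite FIm.
  by apply/eqP; rewrite eq_complex /= -rE -jE !eqxx.
have D := mfunD (gamma_momentC nu); have Z := mfunZ (gamma_momentC nu).
have d := mfun_deriv (gamma_momentCS nu_gtN1).
rewrite /V (ell_gdual_eigen D Z d (2 * ((theta - 1) / 2)%:C%C) (L m)
  (laguerreC_eigen nu k) (leq_maxr (size (L k)) k.+1)).
rewrite mfun_laguerreC//.
(* The base 1 + tau of the collapsed binomial sum is theta. *)
have -> : 1 + 2 * ((theta - 1) / 2)%:C%C = theta%:C%C :> R[i].
  transitivity ((1 + 2 * ((theta - 1) / 2))%:C%C : R[i]).
    rewrite [RHS]rmorphD [X in _ = _ + X]rmorphM.
    by rewrite !(rmorph1, rmorph_nat).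
  by congr _%:C%C; field.
rewrite -rmorphXn -!rmorphM; congr _%:C%C.
(* The prefactor of the theorem is the inverse of [bessel_const]. *)
rewrite /bessel_const mulNr powRN.
have : theta `^ (nu / 2) != 0 by rewrite gt_eqF// powR_gt0// (lt_trans _ theta_gt1).
have : pi != 0 :> R by rewrite gt_eqF ?pi_gt0.
have : k`!%:R != 0 :> R by rewrite pnatr_eq0 -lt0n fact_gt0.
have : theta - 1 != 0 by rewrite gt_eqF// subr_gt0.
move: (pi : R) (theta `^ (nu / 2)) (k`!%:R) (theta - 1) => p q r s s0 r0 p0 q0.
by field; rewrite s0 r0 p0 q0.
Qed.
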